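(* Let $G$ be a countable group, and let $(X,c)$ be a nonempty countable cyclically ordered $G$-set with subexponential growth of orbits. Then there exist an action $\rho\colon G\to\mathrm{Diff}^1_+(\mathbb{S}^1)$ and a family of open intervals $(J_x)_{x\in X}$ in $\mathbb{S}^1$ such that: (i) if $x\neq y$, then $J_x\cap J_y=\varnothing$, and $\bigcup_{x\in X}J_x$ is dense in $\mathbb{S}^1$; (ii) the map $X\to\mathbb{S}^1$ that associates to $x$ the left (equivalently, the right) endpoint of $J_x$ is cyclic-order-preserving; (iii) $\rho(g)(J_x)=J_{gx}$ for every $g\in G$ and $x\in X$, and if $gx=x$ then $\rho(g)$ is the identity on $J_x$. Furthermore, given any finite subset $S\subset G$ and any $\varepsilon>0$, the action $\rho$ above can be chosen such that $\sup_{\xi\in\mathbb{S}^1}|D\rho(s)(\xi)-1|<\varepsilon$ for every $s\in S$.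
   Context: A $G$-set is a set with an action of $G$. A $G$-set $X$ has subexponential growth of orbits if for every nonempty finite subset $S\subset G$ and every $x\in X$, $\lim_{n\to\infty}|S^nx|^{1/n}=1$, where $S^nx=\{s_1\cdots s_nx : s_j\in S\}$ (no uniformity in $S$ or $x$ is required). A circular (or cyclic) order on a set $X$ is a function $c\colon X\times X\times X\to\{0,1,-1\}$ such that for all $x_1,x_2,x_3,x_4\in X$: (1) $c(x_1,x_2,x_3)=0$ if and only if $x_i=x_j$ for some $i\neq j$; (2) $c(x_2,x_3,x_4)-c(x_1,x_3,x_4)+c(x_1,x_2,x_4)-c(x_1,x_2,x_3)=0$. A map $f\colon(X,c_X)\to(Y,c_Y)$ is cyclic-order-preserving if $c_Y(f(x_1),f(x_2),f(x_3))=c_X(x_1,x_2,x_3)$ for all $x_1,x_2,x_3\in X$. A cyclically ordered $G$-set is a cyclically ordered set $(X,c)$ on which $G$ acts by cyclic-order-preserving transformations. The circle $\mathbb{S}^1=\mathbb{R}/\mathbb{Z}$ carries its standard orientation and circular order, where $c(x,y,z)=1$ if $x,y,z$ are distinct and positively ordered, $-1$ if they are distinct and negatively ordered. Open intervals in $\mathbb{S}^1$ are nonempty, and are images of intervals $(a,b)\subset\mathbb{R}$ with $0<b-a\le 1$; the left and right endpoints are the images of $a$ and $b$. $\mathrm{Diff}^1_+(\mathbb{S}^1)$ is the group of orientation-preserving $C^1$ diffeomorphisms of $\mathbb{S}^1$, and $Df$ denotes the derivative of $f$. An action $\rho\colon G\to\mathrm{Diff}^1_+(\mathbb{S}^1)$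 is a group homomorphism. *)

(* Defs.v *)
From HB Require Import structures.
From mathcomp Require Import all_boot all_order all_algebra.
From mathcomp Require Import finmap.
From mathcomp Require Import all_classical all_reals all_analysis.

Set Implicit Arguments.
Unset Strict Implicit.
Unset Printing Implicit Defensive.

Import Order.TTheory GRing.Theory Num.Theory.
Import numFieldNormedType.Exports.

Local Open Scope classical_set_scope.
Local Open Scope ring_scope.
Local Open Scope quotient_scope.

Section GSets.
Variables (G : groupType) (X : choiceType).

Definition left_action (act : G -> X -> X) : Prop :=
  (forall x, act 1%g x = x) /\
  (forall g h x, act (g * h)%g x = act g (act h x)).

Definition power_orbit (act : G -> X -> X) (S : set G) (n : nat) (x : X) :
  set X :=
  [set act (\prod_(g <- s) g)%g x | s in
    [set s : n.-tuple G | forall i, S (tnth s i)]].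

(* [power_orbit act S n x] is finite when [S] is, so that [fset_set] does
   compute its cardinality in the definition below. *)
Definition subexponential_orbits (R : realType) (act : G -> X -> X) : Prop :=
  forall (S : set G) (x : X), finite_set S -> S !=set0 ->
    (#|` fset_set (power_orbit act S n x)|%:R : R) `^ n%:R^-1
      @[n --> \oo] --> (1 : R).

End GSets.

Definition circular_order (X : Type) (c : X -> X -> X -> int) : Prop :=
  [/\ forall x1 x2 x3, c x1 x2 x3 \in [:: 0; 1; -1],
      forall x1 x2 x3, c x1 x2 x3 = 0 <-> [\/ x1 = x2, x1 = x3 | x2 = x3]
    & forall x1 x2 x3 x4,
        c x2 x3 x4 - c x1 x3 x4 + c x1 x2 x4 - c x1 x2 x3 = 0].

Definition cyclic_order_preserving (X Y : Type)
    (cX : X -> X -> X -> int) (cY : Y -> Y -> Y -> int) (f : X -> Y) : Prop :=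
  forall x1 x2 x3, cY (f x1) (f x2) (f x3) = cX x1 x2 x3.

(* R/Z, with the quotient group structure and the quotient topology.
   [Num.int_num_subdef] is the predicate underlying [x \is a Num.int]. *)
Definition circle (R : realType) : Type :=
  Quotient.quot (GRing.ZmodClosed.clone R (@Num.int_num_subdef R) _).

Section Circle.
Variable R : realType.

HB.instance Definition _ := EqQuotient.on (circle R).
HB.instance Definition _ := GRing.Zmodule.on (circle R).

Definition circle_open (U : set (circle R)) : Prop :=
  open (\pi_(circle R) @^-1` U : set R).

Lemma circle_openT : circle_open setT.
Proof. by rewrite /circle_open preimage_setT; exact: openT. Qed.

Lemma circle_openI : setI_closed circle_open.
Proof. by move=> U V oU oV; exact: openI. Qed.

Lemma circle_open_bigU (I : Type) (f : I -> set (circle R)) :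
  (forall i, circle_open (f i)) -> circle_open (\bigcup_i f i).
Proof. by move=> of_; apply: bigcup_open => i _; exact: of_. Qed.

HB.instance Definition _ := @isOpenTopological.Build (circle R)
  circle_open circle_openT circle_openI circle_open_bigU.

Definition toC (t : R) : circle R := \pi_(circle R) t.

(* the unique representative of [xi] in [a, a + 1[ *)
Definition rep_from (a : R) (xi : circle R) : R :=
  repr xi - (Num.floor (repr xi - a))%:~R.

(* Going once around the circle in the positive direction from [x], the points
   [y] and [z] are met at times [rep_from 0 (y - x)] and
   [rep_from 0 (z - x)]. *)
Definition circle_order (x y z : circle R) : int :=
  if [|| x == y, x == z | y == z] then 0
  else if rep_from 0 (y - x) < rep_from 0 (z - x) then 1 else -1.

(* an open interval of the circle when [0 < b - a <= 1] *)
Definition arc (a b : R) : set (circle R) := toC @` `]a, b[.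

(* [f] read in the standard charts [xi + toC t <-> t] around [xi] and
   [f xi + toC t <-> t] around [f xi], with [t] in [-1/2, 1/2[ *)
Definition in_charts (f : circle R -> circle R) (xi : circle R) (t : R) : R :=
  rep_from (- 2^-1) (f (xi + toC t) - f xi).

Definition circle_D (f : circle R -> circle R) (xi : circle R) : R :=
  derive1 (in_charts f xi) 0.

Definition circle_C1 (f : circle R -> circle R) : Prop :=
  (forall xi, derivable (in_charts f xi) 0 1) /\ continuous (circle_D f).

Definition diff1_pos (f : circle R -> circle R) : Prop :=
  [/\ circle_C1 f,
      exists f' : circle R -> circle R,
        [/\ cancel f f', cancel f' f & circle_C1 f']
    & forall xi, 0 < circle_D f xi].

(* a group homomorphism from [G] to the group, under composition, of
   orientation-preserving C^1 diffeomorphisms of the circle *)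
Definition diff1_action (G : groupType) (rho : G -> circle R -> circle R) :
  Prop :=
  (forall g, diff1_pos (rho g)) /\
  (forall g h, rho (g * h)%g = rho g \o rho h).

(* [a x] and [b x] are lifts to the line of the left and
   right endpoints of the interval [J x]. *)
Definition blow_up (G : groupType) (X : choiceType) (act : G -> X -> X)
    (c : X -> X -> X -> int) (rho : G -> circle R -> circle R)
    (J : X -> set (circle R)) : Prop :=
  [/\ (forall x y, x <> y -> J x `&` J y = set0) /\ dense (\bigcup_x J x),
      exists a b : X -> R,
        [/\ forall x, 0 < b x - a x <= 1,
            forall x, J x = arc (a x) (b x),
            cyclic_order_preserving c circle_order (toC \o a)
          & cyclic_order_preserving c circle_order (toC \o b)],
      forall g x, rho g @` J x = J (act g x)
    & forall g x, act g x = x -> forall xi, J x xi -> rho g xi = xi].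

End Circle.

(* Main.v *)
Require Import Defs.
From HB Require Import structures.
From mathcomp Require Import all_boot all_order all_algebra.
From mathcomp Require Import finmap.
From mathcomp Require Import all_classical all_reals all_analysis.
From mathcomp Require Import ring lra zify.

Set Implicit Arguments.
Unset Strict Implicit.
Unset Printing Implicit Defensive.

Import Order.TTheory GRing.Theory Num.Theory.
Import numFieldNormedType.Exports.

Local Open Scope classical_set_scope.
Local Open Scope ring_scope.

(** Give to each point [x] of [X] a length [l x > 0], with total length 1, and put intervals
    of these lengths side by side on the circle, in the circular order of [X]. An element
    [g] of [G] maps the interval of [x] onto that of [g x] by a diffeomorphism taken from a
    family indexed by pairs of lengths. This family satisfies a cocycle relation
    ([gap_map_comp]), which makes the construction an action; it is the identity when the two
    lengths agree, which gives the statement on stabilizers; and its derivative is 1 at the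
    endpoints and lies between 1 and the square of the ratio of the lengths. The family used
    here is a piecewise Moebius variant of that of Yoccoz. Hence the action is of class C^1,
    with derivative 1 off the intervals, as soon as [l (g x) / l x] tends to 1 when [x] leaves
    the finite subsets of [X], for every [g]; and the derivative of [g] is uniformly close to
    1 if all these ratios are close to 1.

    Subexponential growth of orbits provides such lengths ([almost_invariant_weight]). Let
    the finite sets [S j] and [A j] exhaust [G] and [X], let [r j] increase to 1, and
    let [l x] be the supremum of the [eta j * r j ^+ n] over the pairs [(j, n)] such that [x]
    belongs to [S j ^ n A j]. If [g] belongs to [S j], applying [g] increases [n] by at most
    1, which costs a factor [r j]. Near infinity [n] is large, and then the
    indices smaller than any given [i] may be discarded, since [r i] is greater than the
    corresponding [r j]. As the size of [S j ^ n A j] grows subexponentially in [n], the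
    weight is summable when the [eta j] are small enough.

    The circular order becomes a linear order with least element [x0] when it is cut at a
    point [x0], and the left endpoint of the interval of [x] is the sum of the lengths of
    the smaller points ([position]). On the line, the lift of [g] is a translation plus the
    1-periodic extension of a sum of functions, one for each interval, whose derivatives have
    disjoint supports and tend uniformly to 0; termwise differentiation
    ([is_derive_uniform_limit]) shows that it is of class C^1. The lifts compose up to
    integers on the intervals by the cocycle relation, hence everywhere because the union of
    the intervals is dense ([act_lift_comp]). *)

(** * Differentiation on the line *)

Section Calculus.
Variable R : realType.
Implicit Types (f df : R -> R) (t d : R).

(** Differentiability by affine approximation. *)
Lemma is_derive_nearP f t d : is_derive t 1 f d <->
  (forall e : R, 0 < e -> \forall s \near t, `|f s - f t - d * (s - t)| <= e * `|s - t|).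
Proof.
split.
- move=> [fd dE] e e0.
  have : h^-1 *: (f (h + t) - f t) @[h --> 0^'] --> d.
    have -> : (fun h : R => h^-1 *: (f (h + t) - f t)) =
       (fun h => h^-1 *: ((f \o shift t) (h *: 1) - f t)).
      by apply/funext => h /=; rewrite [h *: 1]mulr1.
    by rewrite -dE; exact: fd.
  move/cvgrPdist_le => /(_ e e0); rewrite /dnbhs /within /= => /nbhs_ballP[del /= del0 H].
  apply/nbhs_ballP; exists del => //= s; rewrite /ball /= => st.
  have [->|sNt] := eqVneq s t; first by rewrite !subrr mulr0 subrr normr0 mulr0.
  have h0 : s - t != 0 by rewrite subr_eq0.
  have /= := H (s - t).
  rewrite /ball /= sub0r normrN distrC => /(_ st h0).
  rewrite subrK => /(ler_wpM2r (normr_ge0 (s - t))); rewrite -normrM distrC mulrBl.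
  by rewrite [_ *: _]mulrC divfK // (distrC (f s - f t)).
- move=> H; suff cv : (fun h : R => h^-1 *: ((f \o shift t) (h *: 1) - f t)) @ 0^' --> d.
    by split; [apply/cvg_ex; exists d | exact: cvg_lim cv].
  apply/cvgrPdist_le => e e0; rewrite /dnbhs /within /=.
  have /nbhs_ballP[del /= del0 {}H] := H e e0.
  apply/nbhs_ballP; exists del => //= h; rewrite /ball /= sub0r normrN => hd h0.
  have := H (h + t); rewrite /ball /= opprD addrCA subrr addr0 normrN => /(_ hd).
  rewrite addrK [h *: 1]mulr1 => {}H.
  have hn : 0 < `|h| by rewrite normr_gt0.
  rewrite -(ler_pM2r hn); apply: le_trans H; rewrite -normrM distrC mulrBl.
  by rewrite [_ *: _]mulrC divfK // -normr_gt0.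
Qed.

(** Two functions with the same value and the same derivative at the junction point glue to
    a differentiable function. *)
Lemma is_derive_glue f g (p t d : R) : f p = g p ->
  (t <= p -> is_derive t 1 f d) -> (p <= t -> is_derive t 1 g d) ->
  is_derive t 1 (fun s => if s <= p then f s else g s) d.
Proof.
move=> fg Df Dg; have [tp|tp|tp] := ltgtP t p.
- apply: (@near_eq_is_derive _ _ _ _ _ _ _ _ _ (Df (ltW tp))).
  near=> s; rewrite ifT // ltW //; near: s; exact: lt_nbhsl.
- apply: (@near_eq_is_derive _ _ _ _ _ _ _ _ _ (Dg (ltW tp))).
  near=> s; rewrite ifF //; apply/negbTE; rewrite -ltNge; near: s; exact: lt_nbhsr.
- subst t; apply/is_derive_nearP => e e0.
  have /is_derive_nearP/(_ e e0) Hf := Df (lexx p).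
  have /is_derive_nearP/(_ e e0) Hg := Dg (lexx p).
  near=> s; rewrite lexx; case: ifP => _; first by near: s.
  by rewrite fg; near: s.
Unshelve. all: by end_near. Qed.

Lemma is_derive_continuous f df :
  (forall t, is_derive t 1 f (df t)) -> continuous f.
Proof.
by move=> Df t; apply/differentiable_continuous/derivable1_diffP; case: (Df t).
Qed.

(** Mean value inequality. *)
Lemma is_derive_lipschitz f df (C : R) :
  (forall t, is_derive t 1 f (df t)) -> (forall t, `|df t| <= C) ->
  forall s t, `|f s - f t| <= C * `|s - t|.
Proof.
move=> Df dC s t.
wlog st : s t / t <= s.
  by move=> H; have [/H//|/ltW/H] := leP t s; rewrite distrC (distrC s).
have [|c _ ->] := @MVT_segment R f df t s st (fun x _ => Df x).
  exact/continuous_subspaceT/(is_derive_continuous Df).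
by rewrite normrM ler_wpM2r.
Qed.

(** Differentiation of a limit: pointwise convergence of the functions and uniform
    convergence of the derivatives. *)
Lemma is_derive_uniform_limit (f df : nat -> R -> R) (F D : R -> R) :
  (forall n t, is_derive t 1 (f n) (df n t)) ->
  (forall t, f n t @[n --> \oo] --> F t) ->
  (forall e : R, 0 < e -> exists N, forall n t, (N <= n)%N -> `|df n t - D t| <= e) ->
  forall t, is_derive t 1 F (D t).
Proof.
move=> Df fF dD t; apply/is_derive_nearP => e e0.
have e3 : 0 < e / 4 by rewrite divr_gt0.
have [N HN] := dD _ e3.
have rem s : `|(F s - f N s) - (F t - f N t)| <= e / 2 * `|s - t|.
  have cv : `|(f n s - f N s) - (f n t - f N t)| @[n --> \oo] -->
            `|(F s - f N s) - (F t - f N t)|.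
    by apply: cvg_norm; apply: cvgB; (apply: cvgB; [exact: fF | exact: cvg_cst]).
  have := cvgP _ cv.
  move/limr_le => H; rewrite -(cvg_lim _ cv) //; apply: H.
  exists N => // n /= Nn.
  have Dg (u : R) : is_derive u 1 (f n - f N) (df n u - df N u) by apply: is_deriveB.
  have := is_derive_lipschitz Dg (C := e / 2); apply => u.
  rewrite (_ : df n u - df N u = (df n u - D u) - (df N u - D u)); last by ring.
  apply: le_trans (ler_normB _ _) _.
  have := HN n u Nn; have := HN N u (leqnn N); lra.
have /is_derive_nearP/(_ _ e3) HfN := Df N t.
near=> s.
have h1 := rem s.
have h2 : `|f N s - f N t - df N t * (s - t)| <= e / 4 * `|s - t| by near: s.
have h3 : `|(df N t - D t) * (s - t)| <= e / 4 * `|s - t|.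
  by rewrite normrM ler_wpM2r // HN.
rewrite (_ : F s - F t - D t * (s - t) = ((F s - f N s) - (F t - f N t)) +
   (f N s - f N t - df N t * (s - t)) + (df N t - D t) * (s - t)); last by ring.
apply: le_trans (ler_normD _ _) _.
apply: le_trans (lerD (ler_normD _ _) h3) _.
by apply: le_trans (lerD (lerD h1 h2) (lexx _)) _; lra.
Unshelve. all: by end_near. Qed.

Lemma continuous_uniform_limit (f : nat -> R -> R) (F : R -> R) :
  (forall n, continuous (f n)) ->
  (forall e : R, 0 < e -> exists N, forall n t, (N <= n)%N -> `|f n t - F t| <= e) ->
  continuous F.
Proof.
move=> cf fF t; apply/cvgrPdist_le => e e0.
have e3 : 0 < e / 3 by rewrite divr_gt0.
have [N HN] := fF _ e3.
have /cvgrPdist_le/(_ _ e3) H := cf N t.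
near=> s.
have h1 := HN N t (leqnn N); have h2 := HN N s (leqnn N).
have h3 : `|f N t - f N s| <= e / 3 by near: s.
rewrite (_ : F t - F s = - (f N t - F t) + (f N t - f N s) + (f N s - F s)); last by ring.
apply: le_trans (ler_normD _ _) _.
apply: le_trans (lerD (ler_normD _ _) (lexx _)) _; rewrite normrN; lra.
Unshelve. all: by end_near. Qed.

End Calculus.

(** * An equivariant family of diffeomorphisms between intervals *)

Section GapMap.
Variable R : realType.
Implicit Types a b s t : R.

(** [gap_map a b] maps the interval ]0, a[ onto ]0, b[. On ]0, a / 2] it is the Moebius map
    that adds [2 / b - 2 / a] to [1 / s]; it fixes 0 with derivative 1 and sends
    [a / 2] to [b / 2]. The other half is treated symmetrically, and the map is continued
    by translations outside of the interval. *)
Definition gap_map a b s : R :=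
  if s <= 0 then s
  else if s <= a / 2 then s / (1 + (2 / b - 2 / a) * s)
  else if s <= a then b - (a - s) / (1 + (2 / b - 2 / a) * (a - s))
  else s - a + b.

(** Distance from [s] to the complement of the interval ]0, a[. *)
Definition gap_depth a s : R := Num.max 0 (Num.min s (a - s)).

(** The derivative of [gap_map a b]. *)
Definition gap_deriv a b s : R := (1 + (2 / b - 2 / a) * gap_depth a s) ^- 2.

(* The denominator is an affine interpolation between 1, at 0, and a / b, at a / 2. *)
Lemma gap_den_eq a b s : 0 < a -> 0 < b ->
  1 + (2 / b - 2 / a) * s = (1 - 2 * s / a) + 2 * s / a * (a / b).
Proof. by move=> a0 b0; field; rewrite !gt_eqF. Qed.

Lemma gap_den_gt0 a b s : 0 < a -> 0 < b -> 0 <= s -> s <= a / 2 ->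
  0 < 1 + (2 / b - 2 / a) * s.
Proof.
move=> a0 b0 s0 sa.
have -> : 1 + (2 / b - 2 / a) * s = (a - 2 * s) / a + 2 * s / b.
  by field; rewrite !gt_eqF.
have [->|sN0] := eqVneq s 0; first by rewrite !mulr0 mul0r subr0 addr0 divff ?gt_eqF.
have sp : 0 < s by rewrite lt0r sN0.
have : 0 <= (a - 2 * s) / a by apply: divr_ge0; lra.
have : 0 < 2 * s / b by apply: divr_gt0; lra.
lra.
Qed.

Lemma gap_depth_itv a s : 0 < a -> 0 <= gap_depth a s <= a / 2.
Proof.
move=> a0; rewrite /gap_depth le_max lexx /= ge_max; apply/andP; split; first lra.
by rewrite ge_min; case: (leP s (a / 2)) => //= sa; lra.
Qed.

Lemma gap_deriv_gt0 a b s : 0 < a -> 0 < b -> 0 < gap_deriv a b s.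
Proof.
move=> a0 b0; rewrite /gap_deriv invr_gt0 exprn_gt0 // gap_den_gt0 //.
  by case/andP: (gap_depth_itv s a0).
by case/andP: (gap_depth_itv s a0).
Qed.

Lemma gap_deriv_out a b s : ~~ (0 < s < a) -> gap_deriv a b s = 1.
Proof.
move=> sa; rewrite /gap_deriv; suff -> : gap_depth a s = 0 by rewrite mulr0 addr0 expr1n invr1.
apply/max_idPl; rewrite ge_min; move: sa; rewrite negb_and -!leNgt => /orP[->//|sa].
by apply/orP; right; lra.
Qed.

Lemma gap_deriv_bound a b s (r : R) : 0 < a -> 0 < b -> 0 < r <= 1 ->
  r * a <= b -> r * b <= a -> `|gap_deriv a b s - 1| <= r ^- 2 - 1.
Proof.
move=> a0 b0 /andP[r0 r1] rab rba.
have /andP[m0 ma] := gap_depth_itv s a0.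
rewrite /gap_deriv; set m := gap_depth a s in m0 ma *.
set q := 1 + _.
have q0 : 0 < q by exact: gap_den_gt0.
set u := 2 * m / a.
have u0 : 0 <= u by apply: divr_ge0; lra.
have u1 : u <= 1 by rewrite /u ler_pdivrMr //; lra.
have rba' : r <= a / b by rewrite ler_pdivlMr.
have rab' : a / b <= r^-1 by rewrite ler_pdivrMr // mulrC ler_pdivlMr // mulrC.
have ri : 1 <= r^-1 by rewrite invf_ge1.
have qE : q = (1 - u) + u * (a / b) by rewrite /q gap_den_eq.
have rq : r <= q by rewrite qE; nra.
have qr : q <= r^-1 by rewrite qE; nra.
have h1 : q ^- 2 <= r ^- 2 by rewrite lef_pV2 ?posrE ?exprn_gt0 // lerXn2r ?nnegrE // ltW.
have h2 : r ^+ 2 <= q ^- 2.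
  rewrite -[r ^+ 2]invrK lef_pV2 ?posrE ?exprn_gt0 ?invr_gt0 ?exprn_gt0 //.
  by rewrite -exprVn lerXn2r ?nnegrE // ?invr_ge0 ltW.
have h3 : 2 <= r ^+ 2 + r ^- 2.
  have := sqr_ge0 (r - r^-1); rewrite sqrrB -exprVn divff ?gt_eqF //; lra.
rewrite ler_norml; apply/andP; split; lra.
Qed.

Lemma gap_depth_continuous a : continuous (gap_depth a).
Proof.
move=> s; have c1 : {for s, continuous (fun x : R => a - x)}.
  by apply: cvgB; [exact: cvg_cst | exact: cvg_id].
have c2 := @continuous_min R R id (fun x => a - x) s cvg_id c1.
exact: (@continuous_max R R (cst 0) (id \min (fun x => a - x)) s (@cst_continuous _ _ _ _) c2).
Qed.

Lemma gap_deriv_continuous a b : 0 < a -> 0 < b -> continuous (gap_deriv a b).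
Proof.
move=> a0 b0 s; rewrite /gap_deriv.
apply: cvgV.
  rewrite expf_neq0 // gt_eqF // gap_den_gt0 //; by case/andP: (gap_depth_itv s a0).
rewrite -[X in _ --> X]/((fun x => (1 + (2 / b - 2 / a) * gap_depth a x) ^+ 2) s).
apply: (@continuous_comp _ _ _ (fun x => 1 + (2 / b - 2 / a) * gap_depth a x) (fun y => y ^+ 2)).
  apply: cvgD; first exact: cvg_cst.
  by apply: cvgMr; exact: gap_depth_continuous.
exact: exprn_continuous.
Qed.

Lemma is_derive_moebius (k s : R) : 1 + k * s != 0 ->
  is_derive s 1 (fun x => x / (1 + k * x)) ((1 + k * s) ^- 2).
Proof.
move=> h.
have D1 : is_derive s 1 (fun x => 1 + k * x) k.
  have -> : (fun x => 1 + k * x) = cst 1 + k *: (id : R -> R) by [].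
  by apply: is_derive_eq; rewrite add0r [k *: 1]mulr1.
have D2 := @is_deriveV R (fun x => 1 + k * x) s k 1 h D1.
have -> : (fun x => x / (1 + k * x)) = (id : R -> R) * (fun x => (1 + k * x)^-1) by [].
apply: is_derive_eq; rewrite /= /GRing.scale /=; field; exact: h.
Qed.

Lemma gap_map_is_derive a b s : 0 < a -> 0 < b ->
  is_derive s 1 (gap_map a b) (gap_deriv a b s).
Proof.
move=> a0 b0; rewrite /gap_map; set k := 2 / b - 2 / a.
have ka : k * (a / 2) = a / b - 1 by rewrite /k; field; rewrite !gt_eqF.
have kden t : 0 <= t -> t <= a / 2 -> 1 + k * t != 0.
  by move=> t0 ta; rewrite gt_eqF // gap_den_gt0.
apply: is_derive_glue => [|s0|s0]; first by rewrite ifT ?mul0r //; lra.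
  by rewrite gap_deriv_out; [exact: is_derive_id | lra].
apply: is_derive_glue => [|sa|sa].
- rewrite ifT; last lra.
  have -> : a - a / 2 = a / 2 by lra.
  by rewrite ka; field; rewrite !gt_eqF //; lra.
- have -> : gap_deriv a b s = (1 + k * s) ^- 2.
    rewrite /gap_deriv /gap_depth.
    have -> : Num.min s (a - s) = s by apply/min_idPl; lra.
    by have -> : Num.max 0 s = s by apply/max_idPr.
  exact: is_derive_moebius (kden _ s0 sa).
apply: is_derive_glue => [|{}sa'|{}sa'].
- by rewrite subrr mul0r subr0 add0r.
- have dE : gap_deriv a b s = (1 + k * (a - s)) ^- 2.
    rewrite /gap_deriv /gap_depth.
    have -> : Num.min s (a - s) = a - s by apply/min_idPr; lra.
    by have -> : Num.max 0 (a - s) = a - s by apply/max_idPr; lra.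
  have D1 : is_derive s 1 (fun x => a - x) (- 1).
    have -> : (fun x => a - x) = cst a - (id : R -> R) by [].
    by apply: is_derive_eq; rewrite add0r.
  have kd : 1 + k * (a - s) != 0 by apply: kden; lra.
  have D2 : is_derive (a - s) 1 (fun x => x / (1 + k * x)) ((1 + k * (a - s)) ^- 2).
    exact: is_derive_moebius.
  have D3 := @is_derive1_comp R (fun x => x / (1 + k * x)) (fun x => a - x) s _ _ D2 D1.
  have -> : (fun s0 => b - (a - s0) / (1 + k * (a - s0))) =
     cst b - ((fun x => x / (1 + k * x)) \o (fun x => a - x)) by [].
  by apply: is_derive_eq; rewrite dE add0r mulrN mulr1 opprK.
- rewrite gap_deriv_out; last lra.
  have -> : (fun s0 => s0 - a + b) = (id : R -> R) - cst a + cst b by [].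
  by apply: is_derive_eq; rewrite subr0 addr0.
Qed.

Lemma gap_mapE a b s : 0 < s < a -> gap_map a b s =
  if s <= a / 2 then s / (1 + (2 / b - 2 / a) * s)
  else b - (a - s) / (1 + (2 / b - 2 / a) * (a - s)).
Proof. by rewrite /gap_map leNgt => /andP[-> /ltW ->]. Qed.

Lemma gap_map_itv a b s : 0 < a -> 0 < b -> 0 < s < a -> 0 < gap_map a b s < b.
Proof.
move=> a0 b0 /[dup] /andP[s0 sa] /gap_mapE ->.
set k := 2 / b - 2 / a.
(* On a half interval the image is between 0 and b / 2. *)
have half t : 0 < t -> t <= a / 2 -> 0 < t / (1 + k * t) <= b / 2.
  move=> t0 ta; have d0 := gap_den_gt0 a0 b0 (ltW t0) ta.
  rewrite divr_gt0 //= ler_pdivrMr // /k.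
  have -> : b / 2 * (1 + (2 / b - 2 / a) * t) = t + (a / 2 - t) * (b / a).
    by field; rewrite !gt_eqF.
  by rewrite lerDl mulr_ge0 ?divr_ge0 //; lra.
case: (leP s (a / 2)) => sh.
  by have /andP[-> h] := half _ s0 sh; lra.
have /andP[] : 0 < (a - s) / (1 + k * (a - s)) <= b / 2 by apply: half; lra.
lra.
Qed.

Lemma gap_map_lt_half a b s : 0 < a -> 0 < b -> 0 < s < a ->
  (gap_map a b s <= b / 2) = (s <= a / 2).
Proof.
move=> a0 b0 /[dup] /andP[s0 sa] /gap_mapE ->.
set k := 2 / b - 2 / a.
have half t : 0 < t -> t <= a / 2 -> t / (1 + k * t) <= b / 2.
  move=> t0 ta; have d0 := gap_den_gt0 a0 b0 (ltW t0) ta.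
  rewrite ler_pdivrMr // /k.
  have -> : b / 2 * (1 + (2 / b - 2 / a) * t) = t + (a / 2 - t) * (b / a).
    by field; rewrite !gt_eqF.
  by rewrite lerDl mulr_ge0 ?divr_ge0 //; lra.
case: (leP s (a / 2)) => sh; first exact: half.
apply/negbTE; rewrite -ltNge.
have t0 : 0 < a - s by lra.
have ta : a - s <= a / 2 by lra.
have d0 := gap_den_gt0 a0 b0 (ltW t0) ta.
suff : (a - s) / (1 + k * (a - s)) < b / 2 by lra.
rewrite ltr_pdivrMr // /k.
have -> : b / 2 * (1 + (2 / b - 2 / a) * (a - s)) = (a - s) + (a / 2 - (a - s)) * (b / a).
  by field; rewrite !gt_eqF.
by rewrite ltrDl mulr_gt0 ?divr_gt0 //; lra.
Qed.

Lemma moebius_comp (u v w s : R) : 1 + (v - u) * s != 0 -> 1 + (w - u) * s != 0 ->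
  (s / (1 + (v - u) * s)) / (1 + (w - v) * (s / (1 + (v - u) * s))) =
  s / (1 + (w - u) * s).
Proof.
move=> h1 h2.
have -> : 1 + (w - v) * (s / (1 + (v - u) * s)) = (1 + (w - u) * s) / (1 + (v - u) * s).
  by field; exact: h1.
by field; rewrite h1 h2.
Qed.

(** The cocycle relation: on each half, the maps are translations in the coordinate given
    by the inverse of the distance to the nearest endpoint. *)
Lemma gap_map_comp a b (c : R) s : 0 < a -> 0 < b -> 0 < c -> 0 < s < a ->
  gap_map b c (gap_map a b s) = gap_map a c s.
Proof.
move=> a0 b0 c0 sa.
rewrite (gap_mapE _ (gap_map_itv a0 b0 sa)) (gap_map_lt_half a0 b0 sa) !gap_mapE //.
case/andP: sa => s0 sa.
have [sh|sh] := leP s (a / 2).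
  by apply: moebius_comp; rewrite gt_eqF // gap_den_gt0 // ltW.
have -> u : b - (b - u) = u by ring.
congr (c - _); apply: moebius_comp; rewrite gt_eqF // gap_den_gt0 //; lra.
Qed.

Lemma gap_map_id a s : 0 < a -> gap_map a a s = s.
Proof.
move=> a0; rewrite /gap_map subrr !mul0r addr0 !divr1; do 3 (case: ifP => _ //); lra.
Qed.

Lemma gap_map_le0 a b s : s <= 0 -> gap_map a b s = s.
Proof. by rewrite /gap_map => ->. Qed.

Lemma gap_map_ge a b s : 0 < a -> a <= s -> gap_map a b s = s - a + b.
Proof.
move=> a0 sa; rewrite /gap_map ifF; last by apply/negbTE; rewrite -ltNge; lra.
rewrite ifF; last by apply/negbTE; rewrite -ltNge; lra.
case: ifP => // sa'; have -> : s = a by lra.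
by rewrite subrr mul0r subr0 add0r.
Qed.

End GapMap.

(** * Growth of orbits *)

Section Growth.
Variables (R : realType) (G : groupType) (X : choiceType) (act : G -> X -> X).
Hypothesis actP : left_action act.

(** [orbit_ball S A n] lists, without repetition, the points [s_1 ... s_n x] with the [s_i]
    in [S] and [x] in [A]. *)
Definition orbit_ball (S : seq G) (A : seq X) (n : nat) : seq X :=
  iter n (fun B => undup [seq act g y | g <- S, y <- B]) (undup A).

Lemma ball_uniq S A n : uniq (orbit_ball S A n).
Proof. by case: n => [|n]; rewrite /orbit_ball /= undup_uniq. Qed.

Lemma ballS S A n g x : g \in S -> x \in orbit_ball S A n -> act g x \in orbit_ball S A n.+1.
Proof. by move=> gS xB; rewrite /= mem_undup; apply/allpairsP; exists (g, x). Qed.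

Lemma ball_sub S S' A A' n : {subset S <= S'} -> {subset A <= A'} ->
  {subset orbit_ball S A n <= orbit_ball S' A' n}.
Proof.
move=> sS sA; elim: n => [|n IH] x; first by rewrite /= !mem_undup; exact: sA.
rewrite [X in X -> _]/= mem_undup => /allpairsP[[g y] /= [gS yB ->]].
by apply: ballS; [exact: sS | exact: IH].
Qed.

Lemma mem_ball S A n y : y \in orbit_ball S A n <->
  exists2 x, x \in A & power_orbit act [set` S] n x y.
Proof.
elim: n y => [|n IH] y.
  rewrite /= mem_undup; split => [yA|[x xA [s _ <-]]].
    exists y => //; exists [tuple] => /=; first by case.
    by rewrite big_nil actP.1.
  by rewrite tuple0 big_nil actP.1.
split.
  rewrite /= mem_undup => /allpairsP[[g z] /= [gS /IH[x xA [s sS <-]] ->]].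
  exists x => //; exists [tuple of g :: s].
    by move=> i; case: (unliftP ord0 i) => [j ->|->]; rewrite ?tnthS ?tnth0.
  by rewrite /= big_cons actP.2.
move=> [x xA [s sS <-]]; case/tupleP: s sS => g s sS.
rewrite /= big_cons actP.2; apply: ballS; first by have := sS ord0; rewrite tnth0.
apply/IH; exists x => //; exists s => // i.
by have := sS (lift ord0 i); rewrite tnthS.
Qed.

Lemma power_orbit_finite (S : seq G) n x : finite_set (power_orbit act [set` S] n x).
Proof.
apply: (@sub_finite_set _ _ [set` orbit_ball S [:: x] n]); last exact: finite_seq.
by move=> y H /=; apply/mem_ball; exists x; rewrite ?mem_head.
Qed.

Lemma size_ball (S : seq G) A n :
  (size (orbit_ball S A n) <= \sum_(x <- A) #|` fset_set (power_orbit act [set` S] n x)|)%N.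
Proof.
have -> : (\sum_(x <- A) #|` fset_set (power_orbit act [set` S] n x)|)%N =
  size (flatten [seq enum_fset (fset_set (power_orbit act [set` S] n x)) | x <- A]).
  by rewrite size_flatten /shape -map_comp sumnE big_map.
apply: uniq_leq_size (ball_uniq _ _ _) _ => y /mem_ball[x xA xy].
apply/flatten_mapP; exists x => //.
by rewrite in_fset_set; [exact: mem_set xy | exact: power_orbit_finite].
Qed.

Lemma root_cvg1_bound (u : nat -> nat) (q : R) : 0 < q < 1 ->
  ((u n)%:R : R) `^ n%:R^-1 @[n --> \oo] --> (1 : R) ->
  exists C : R, forall n, (u n)%:R * q ^+ n <= C.
Proof.
move=> /andP[q0 q1] /cvgrPdist_lt H.
have iq : 0 < q^-1 - 1 by rewrite subr_gt0 invf_gt1.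
have [N _ HN] := H _ iq.
exists (1 + \sum_(i < N.+1) (u i)%:R * q ^+ i) => n.
have t0 i : 0 <= (u i)%:R * q ^+ i by rewrite mulr_ge0 // exprn_ge0 // ltW.
have [nN|Nn] := ltnP n N.+1.
  rewrite (bigD1 (Ordinal nN)) //= addrCA lerDl addr_ge0 // sumr_ge0 //.
apply: ler_wpDr; first by apply: sumr_ge0 => i _; exact: t0.
have n0 : n%:R != 0 :> R by rewrite pnatr_eq0 -lt0n; exact: leq_trans Nn.
have := HN n (ltnW Nn) => /=; rewrite distrC => /ltW /ler_normlW.
rewrite lerBlDr subrK => le1.
have -> : (u n)%:R = ((u n)%:R `^ n%:R^-1) ^+ n :> R.
  by rewrite -powR_mulrn ?powR_ge0 // -powRrM mulVf // powRr1.
rewrite -exprMn -[leRHS](expr1n _ n) lerXn2r ?nnegrE ?mulr_ge0 ?powR_ge0 ?(ltW q0) //.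
by rewrite -ler_pdivlMr // div1r.
Qed.

Lemma ball_subexp (S : seq G) A (q : R) : S != [::] -> subexponential_orbits R act -> 0 < q < 1 ->
  exists C : R, forall n, (size (orbit_ball S A n))%:R * q ^+ n <= C.
Proof.
move=> S0 sub q01; have q0 : 0 < q by case/andP: q01.
pose u x n := #|` fset_set (power_orbit act [set` S] n x)|.
have Hx x : exists C : R, forall n, (u x n)%:R * q ^+ n <= C.
  apply: root_cvg1_bound => //; apply: sub; first exact: finite_seq.
  have [g gS] : exists g, g \in S.
    by move: S0; clear; case: S => // g S _; exists g; rewrite mem_head.
  by exists g.
have [C HC] := choice Hx.
exists (\sum_(x <- A) C x) => n.
apply: (@le_trans _ _ ((\sum_(x <- A) u x n)%N%:R * q ^+ n)).
  by rewrite ler_wpM2r ?exprn_ge0 ?(ltW q0) // ler_nat size_ball.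
by rewrite natr_sum mulr_suml ler_sum.
Qed.

Lemma geometric_le (t : R) N : 0 <= t < 1 -> \sum_(n < N) t ^+ n <= (1 - t)^-1.
Proof.
move=> /andP[t0 t1]; have t1' : 0 < 1 - t by rewrite subr_gt0.
rewrite -[leRHS]div1r ler_pdivlMr // mulrC.
have := subrX1 t N => H; rewrite -opprB mulNr -H opprB lerBlDr lerDl.
exact: exprn_ge0.
Qed.

Lemma ball_sum_bound (S : seq G) A (q : R) :
  S != [::] -> subexponential_orbits R act -> 0 < q < 1 ->
  exists2 K : R, 0 < K &
    forall N, \sum_(n < N) (size (orbit_ball S A n))%:R * q ^+ n <= K.
Proof.
move=> S0 sub /andP[q0 q1].
(* A growth bound at a rate [p] between [q] and 1 leaves a convergent geometric series. *)
pose p := (1 + q) / 2.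
have p0 : 0 < p by rewrite /p; lra.
have p1 : p < 1 by rewrite /p; lra.
have qp : q < p by rewrite /p; lra.
have t01 : 0 <= q / p < 1 by rewrite divr_ge0 ?ltW //= ltr_pdivrMr // mul1r.
have [|C HC] := @ball_subexp S A p S0 sub; first by rewrite p0.
have C0 : 0 <= C.
  by apply: le_trans (HC 0%N); rewrite mulr_ge0 // exprn_ge0 // ltW.
have i0 : 0 < (1 - q / p)^-1 by rewrite invr_gt0 subr_gt0; case/andP: t01.
exists (C * (1 - q / p)^-1 + 1).
  by rewrite ltr_wpDl // mulr_ge0 // ltW.
move=> N; apply: ler_wpDr => //.
apply: le_trans (ler_wpM2l C0 (geometric_le N t01)).
rewrite mulr_sumr ler_sum // => n _.
have -> : q ^+ n = p ^+ n * (q / p) ^+ n by rewrite -exprMn mulrCA divff ?gt_eqF // mulr1.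
by rewrite mulrA ler_wpM2r // exprn_ge0 //; case/andP: t01.
Qed.

End Growth.

(** * Almost invariant summable weights *)

Lemma countable_enum (T : Type) (x0 : T) : countable [set: T] ->
  exists f : nat -> T, forall x, exists n, f n = x.
Proof.
move=> /countable_injP[h hinj].
have H n : exists x, forall y, h y = n -> x = y.
  have [[x hx]|Nx] := pselect (exists x, h x = n).
    by exists x => y hy; apply: hinj; rewrite ?inE // hx.
  by exists x0 => y hy; case: Nx; exists y.
have [f Hf] := choice H.
by exists f => x; exists (h x); apply: Hf.
Qed.

Section Weights.
Variables (R : realType) (G : groupType) (X : choiceType) (act : G -> X -> X).
Hypotheses (countG : countable [set: G]) (countX : countable [set: X]).
Hypotheses (actP : left_action act) (subexp : subexponential_orbits R act).

(** On a countable [G]-set with subexponential growth of orbits there is a positive summable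
    weight which is almost invariant at infinity, and almost invariant everywhere for the
    elements of a prescribed finite set. It is the supremum of the [eta j * r j ^+ n] over the
    balls [orbit_ball (S j) (A j) n] that contain the point, where the finite sets [S j] and
    [A j] exhaust [G] and [X] and [r j] increases to 1. *)
Lemma almost_invariant_weight (x0 : X) (S0 : seq G) (r0 : R) : 0 < r0 < 1 ->
  exists l : X -> R, [/\ forall x, 0 < l x,
    exists C, forall s : seq X, uniq s -> \sum_(x <- s) l x <= C,
    forall g (e : R), 0 < e -> exists s : seq X,
      forall x, x \notin s -> (1 - e) * l x <= l (act g x)
  & forall g x, g \in S0 -> r0 * l x <= l (act g x)].
Proof.
move=> /andP[r00 r01].
have [gen genP] := countable_enum (1%g : G) countG.
have [pts ptsP] := countable_enum x0 countX.
pose S (j : nat) : seq G := 1%g :: S0 ++ [seq gen i | i <- iota 0 j].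
pose A (j : nat) : seq X := [seq pts i | i <- iota 0 j].
pose B j n := orbit_ball act (S j) (A j) n.
pose r (j : nat) : R := 1 - (1 - r0) / j.+1%:R.
have rmono i j : (i < j)%N -> r i < r j.
  move=> ij; rewrite /r ltrD2l ltrN2 ltr_pM2l ?subr_gt0 //.
  by rewrite ltf_pV2 ?posrE ?ltr0n // ltr_nat.
have rle i j : (i <= j)%N -> r i <= r j.
  by rewrite leq_eqVlt => /orP[/eqP->//|/rmono/ltW].
have r0E : r 0%N = r0 by rewrite /r divr1; lra.
have rgt0 j : 0 < r j by apply: lt_le_trans r00 _; rewrite -r0E rle.
have rlt1 j : r j < 1 by rewrite /r ltrBlDr ltrDl divr_gt0 ?subr_gt0.
have rX01 j n : 0 < r j ^+ n <= 1.
  by rewrite exprn_gt0 //= exprn_ile1 // ltW.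
have rlim (e : R) : 0 < e -> exists j, 1 - e <= r j.
  move=> e0; exists (Num.trunc ((1 - r0) / e)); rewrite /r lerD2l lerN2.
  rewrite ler_pdivrMr ?ltr0n // mulrC -ler_pdivrMr //; apply: ltW.
  by have := Num.Theory.truncnS_gt ((1 - r0) / e).
have Ssub i j : (i <= j)%N -> {subset S i <= S j}.
  move=> ij g; rewrite !inE !mem_cat => /or3P[->//|->|/mapP[k]]; rewrite ?orbT //.
  rewrite mem_iota add0n => /andP[_ ki] ->; apply/or3P; apply: Or33.
  by apply: map_f; rewrite mem_iota add0n (leq_trans ki).
have Asub i j : (i <= j)%N -> {subset A i <= A j}.
  move=> ij g /mapP[k]; rewrite mem_iota add0n => /andP[_ ki] ->.
  by apply: map_f; rewrite mem_iota add0n (leq_trans ki).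
have Bsub i j n : (i <= j)%N -> {subset B i n <= B j n}.
  by move=> ij; apply: ball_sub; [exact: Ssub | exact: Asub].
have Bact i n g x : g \in S i -> x \in B i n -> act g x \in B i n.+1 by exact: ballS.
have /choice[K HK] j : exists K : R, 0 < K /\
    forall N, \sum_(n < N) (size (B j n))%:R * r j ^+ n <= K.
  have [|K K0 HK] := @ball_sum_bound R G X act actP (S j) (A j) (r j) isT subexp.
    by rewrite rgt0 rlt1.
  by exists K.
pose eta (j : nat) : R := (1 + K j)^-1 / 2 ^+ j.
have K1 j : 0 < 1 + K j by rewrite addr_gt0 //; case: (HK j).
have eta0 j : 0 < eta j by rewrite divr_gt0 ?invr_gt0 ?exprn_gt0.
have eta1 j : eta j <= 1.
  rewrite /eta ler_pdivrMr ?exprn_gt0 // mul1r.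
  apply: (@le_trans _ _ 1); last by rewrite exprn_ege1 // ler1n.
  by rewrite invf_le1 // lerDl ltW //; case: (HK j).
pose w j n := eta j * r j ^+ n.
have w0 j n : 0 < w j n by case/andP: (rX01 j n) => h _; rewrite mulr_gt0.
have w1 j n : w j n <= 1.
  case/andP: (rX01 j n) => h1 h2.
  by rewrite -[leRHS]mul1r ler_pM // ltW.
pose W x : set R := [set u | exists j n, x \in B j n /\ u = w j n].
pose l x := sup (W x).
have xB x : exists j, x \in B j 0%N.
  have [k <-] := ptsP x; exists k.+1; change (pts k \in undup (A k.+1)); rewrite mem_undup.
  by apply: map_f; rewrite mem_iota add0n /=.
have Wsup x : has_sup (W x).
  split; last by exists 1 => _ [j [n [_ ->]]].
  by have [j xj] := xB x; exists (w j 0%N), j, 0%N.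
have lge x j n : x \in B j n -> w j n <= l x.
  by move=> xjn; apply: ub_le_sup; [case: (Wsup x) | exists j, n].
have lle x (M : R) : (forall j n, x \in B j n -> w j n <= M) -> l x <= M.
  move=> H; apply: ge_sup; first by case: (Wsup x).
  by move=> _ [j [n [xjn ->]]]; exact: H.
have l0 x : 0 < l x by have [j /lge] := xB x; apply: lt_le_trans.
(* The weight at index [j] loses at most a factor [r j] under [S j]. *)
have step i j n g x : (i <= j)%N -> g \in S i -> x \in B j n ->
    r i * w j n <= l (act g x).
  move=> ij gS xB'; apply: le_trans (lge _ _ _ (Bact _ _ _ _ (Ssub _ _ ij _ gS) xB')).
  rewrite /w exprS mulrCA ler_pM2l // ler_wpM2r ?rle //.
  by case/andP: (rX01 j n) => /ltW.
exists l; split => //.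
- exists (2 * 2) => s us.
  (* [l x] is at most twice one of the weights of which it is the supremum; the sum of these
     is then taken over the balls rather than over the points. *)
  have /choice[jn Hjn] x : exists p : nat * nat, x \in B p.1 p.2 /\ l x <= 2 * w p.1 p.2.
    have hx : 0 < l x / 2 by rewrite divr_gt0.
    have [_ [j [n [xjn ->]]]] := sup_adherent hx (Wsup x).
    rewrite -/(l x) => h; exists (j, n) => /=; split => //; lra.
  pose N := (\max_(x <- s) maxn (jn x).1 (jn x).2).+1.
  have jnN x : x \in s -> ((jn x).1 < N)%N /\ ((jn x).2 < N)%N.
    move=> xs; have := @leq_bigmax_seq _ s xpredT (fun x => maxn (jn x).1 (jn x).2) x xs isT.
    by rewrite geq_max !ltnS => /andP.
  have lex x : x \in s -> l x <=
      2 * \sum_(j < N) \sum_(n < N) w j n * (x \in B j n)%:R.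
    move=> xs; have [j1 n1] := jnN _ xs; have [xjn lx] := Hjn x.
    apply: le_trans lx _; rewrite ler_pM2l //.
    have p0 (j n : nat) : 0 <= w j n * (x \in B j n)%:R by rewrite mulr_ge0 // ltW.
    rewrite (bigD1 (Ordinal j1)) //= (bigD1 (Ordinal n1)) //= xjn mulr1 -addrA lerDl.
    by rewrite addr_ge0 // sumr_ge0 // => i _; rewrite ?sumr_ge0.
  apply: (@le_trans _ _ (\sum_(x <- s) 2 * \sum_(j < N) \sum_(n < N) w j n * (x \in B j n)%:R)).
    by rewrite big_seq [leRHS]big_seq ler_sum.
  rewrite -mulr_sumr ler_pM2l // exchange_big /=.
  apply: (@le_trans _ _ (\sum_(j < N) (2^-1) ^+ j)); last first.
    apply: le_trans (geometric_le _ _) _; first by rewrite invr_ge0 ler0n invf_lt1 // ltr1n.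
    by have -> : (1 - 2^-1)^-1 = 2 :> R by field.
  apply: ler_sum => j _; rewrite exchange_big /=.
  have [Kj HKj] := HK j.
  apply: (@le_trans _ _ (eta j * K j)).
    apply: le_trans (ler_wpM2l (ltW (eta0 j)) (HKj N)).
    rewrite mulr_sumr; apply: ler_sum => n _.
    rewrite -mulr_sumr /w -mulrA ler_pM2l // mulrC ler_wpM2r //.
      by case/andP: (rX01 j n) => /ltW.
    rewrite -natr_sum ler_nat.
    have -> : (\sum_(x <- s) (x \in B j n) = size [seq x <- s | x \in B j n])%N.
      by rewrite size_filter -sum1_count [RHS]big_mkcond /=; apply: eq_bigr => x _; case: (_ \in _).
    apply: uniq_leq_size; first exact: filter_uniq.
    by move=> x; rewrite mem_filter => /andP[].
  rewrite /eta mulrAC -exprVn ler_piMl ?exprn_ge0 ?invr_ge0 //.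
  by rewrite mulrC ler_pdivrMr // mul1r lerDr.
- move=> g e e0.
  have [j0 Hj0] := rlim e e0.
  have [k0 gk] := genP g.
  pose i := maxn j0 k0.+1.
  have gS : g \in S i.
    rewrite !inE mem_cat -gk map_f ?orbT // mem_iota add0n /= /i.
    exact: leq_maxr.
  have rie : 1 - e <= r i by apply: le_trans Hj0 _; apply: rle; exact: leq_maxl.
  (* Beyond some radius the index [i] dominates all smaller ones. *)
  have /choice[n0 Hn0] j : exists n0, (j < i)%N -> forall n, (n0 <= n)%N -> w j n <= w i n.
    have [ij|ji] := leqP i j; first by exists 0%N.
    have q01 : `|r j / r i| < 1.
      rewrite ger0_norm ?divr_ge0 ?ltW // ltr_pdivrMr // mul1r; exact: rmono.
    have /cvgrPdist_lt/(_ (eta i / eta j)) := cvg_expr q01.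
    rewrite divr_gt0 // => /(_ isT) [n0 _ H]; exists n0 => _ n /H /=.
    rewrite sub0r normrN => /ltW /ler_normlW; rewrite expr_div_n.
    rewrite ler_pdivrMr ?exprn_gt0 // mulrAC ler_pdivlMr // /w.
    by rewrite [leLHS]mulrC.
  pose far := flatten [seq flatten [seq B j n | n <- iota 0 (n0 j)] | j <- iota 0 i].
  exists far => x xfar.
  apply: (@le_trans _ _ (r i * l x)); first by rewrite ler_wpM2r // ltW.
  rewrite mulrC -ler_pdivlMr //; apply: lle => j n xjn.
  rewrite ler_pdivlMr // mulrC.
  have [ij|ji] := leqP i j; first exact: step.
  have nn0 : (n0 j <= n)%N.
    rewrite leqNgt; apply/negP => nn0; move/negP: xfar; apply.
    apply/flatten_mapP; exists j; first by rewrite mem_iota.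
    by apply/flatten_mapP; exists n; rewrite ?mem_iota.
  apply: le_trans (step i i n g x (leqnn i) gS (Bsub _ _ _ (ltnW ji) _ xjn)).
  by rewrite ler_pM2l // Hn0.
- move=> g x gS0.
  rewrite mulrC -ler_pdivlMr //; apply: lle => j n xjn.
  rewrite ler_pdivlMr // mulrC -r0E; apply: step => //.
  by rewrite !inE mem_cat gS0 orbT.
Qed.

End Weights.

(** * Sums over a countable set *)

Section Sums.
Variables (R : realType) (X : choiceType) (pts : nat -> X).
Hypothesis ptsP : forall x, exists n, pts n = x.
Implicit Types (f g : X -> R) (s : seq X).

(** Sums over the countable set [X] are limits along the finite sets [first_pts N], which
    exhaust it; [Sum f] is meaningful when [f] is absolutely summable. *)
Definition first_pts (N : nat) : seq X := undup [seq pts i | i <- iota 0 N].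

Definition Sum f : R := lim ((\sum_(x <- first_pts N) f x) @[N --> \oo]).

(** Absolute summability. *)
Definition asummable f := exists C : R, forall s, uniq s -> \sum_(x <- s) `|f x| <= C.

Lemma first_pts_uniq N : uniq (first_pts N).
Proof. exact: undup_uniq. Qed.

Lemma first_pts_sub N M : (N <= M)%N -> {subset first_pts N <= first_pts M}.
Proof.
move=> NM x; rewrite !mem_undup => /mapP[k]; rewrite mem_iota add0n => /andP[_ kN] ->.
by apply: map_f; rewrite mem_iota add0n (leq_trans kN).
Qed.

Lemma first_pts_exhaust s : exists N, {subset s <= first_pts N}.
Proof.
elim: s => [|x s [N HN]]; first by exists 0%N.
have [k kx] := ptsP x; exists (maxn N k.+1) => y; rewrite inE => /predU1P[->|/HN].
  by rewrite mem_undup -kx map_f // mem_iota add0n /= leq_maxr.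
by apply: first_pts_sub; exact: leq_maxl.
Qed.

Lemma ler_sum_sub f s s' : (forall x, 0 <= f x) -> uniq s -> {subset s <= s'} ->
  \sum_(x <- s) f x <= \sum_(x <- s') f x.
Proof.
move=> f0; elim: s s' => [|x s IH] s' /=; first by rewrite big_nil sumr_ge0.
move=> /andP[xs us] ss'; have xs' : x \in s' by apply: ss'; rewrite mem_head.
rewrite big_cons (perm_big _ (perm_to_rem xs')) big_cons lerD2l.
apply: IH => // y ys; have /ss' := mem_behead (s := x :: s) ys.
rewrite (perm_mem (perm_to_rem xs')) inE => /predU1P[yx|//].
by rewrite -yx ys in xs.
Qed.

Lemma asummable_le f g : asummable g -> (forall x, `|f x| <= g x) -> asummable f.
Proof.
move=> [C HC] fg; exists C => s us; apply: le_trans (HC s us); apply: ler_sum => x _.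
exact: le_trans (fg x) (ler_norm _).
Qed.

Lemma asummableD f g : asummable f -> asummable g -> asummable (fun x => f x + g x).
Proof.
move=> [C HC] [D HD]; exists (C + D) => s us; apply: le_trans (lerD (HC s us) (HD s us)).
by rewrite -big_split ler_sum // => x _; exact: ler_normD.
Qed.

Lemma asummableN f : asummable f -> asummable (fun x => - f x).
Proof. by move=> [C HC]; exists C => s us; under eq_bigr do rewrite normrN; exact: HC. Qed.

Lemma Sum_cvg f : asummable f -> (\sum_(x <- first_pts N) f x) @[N --> \oo] --> Sum f.
Proof.
have pos g : (forall x, 0 <= g x) -> asummable g ->
    cvg ((\sum_(x <- first_pts N) g x) @[N --> \oo]).
  move=> g0 [C HC]; apply: nondecreasing_is_cvgn.
    by move=> N M NM; apply: ler_sum_sub => //; [exact: first_pts_uniq | exact: first_pts_sub].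
  exists C => _ [N _ <-]; apply: le_trans (HC _ (first_pts_uniq N)).
  by apply: ler_sum => x _; exact: ler_norm.
move=> sf; have sn : asummable (fun x => `|f x|).
  by case: sf => C HC; exists C => s us; under eq_bigr do rewrite normr_id; exact: HC.
have c1 := pos _ (fun x => normr_ge0 (f x)) sn.
have c2 : cvg ((\sum_(x <- first_pts N) (f x + `|f x|)) @[N --> \oo]).
  by apply: pos (asummableD sf sn) => x; have := ler_norm (- f x); rewrite normrN; lra.
have fE : (fun N => \sum_(x <- first_pts N) f x) = (fun N =>
   (\sum_(x <- first_pts N) (f x + `|f x|)) - \sum_(x <- first_pts N) `|f x|).
  by apply/funext => N; rewrite big_split /= addrK.
by rewrite /Sum fE; exact: (is_cvgB c2 c1).
Qed.

Lemma SumD f g : asummable f -> asummable g -> Sum (fun x => f x + g x) = Sum f + Sum g.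
Proof.
move=> sf sg; apply: cvg_lim => //.
under eq_fun do rewrite big_split /=.
by apply: cvgD; exact: Sum_cvg.
Qed.

Lemma SumN f : asummable f -> Sum (fun x => - f x) = - Sum f.
Proof.
move=> sf; apply: cvg_lim => //.
under eq_fun do rewrite sumrN.
by apply: cvgN; exact: Sum_cvg.
Qed.

Lemma SumB f g : asummable f -> asummable g -> Sum (fun x => f x - g x) = Sum f - Sum g.
Proof. by move=> sf sg; rewrite SumD ?SumN //; exact: asummableN. Qed.

Lemma Sum_le f C : asummable f -> (forall s, uniq s -> \sum_(x <- s) f x <= C) -> Sum f <= C.
Proof.
move=> /Sum_cvg cf H; rewrite -(cvg_lim _ cf) //; apply: limr_le; first exact: cvgP cf.
by near=> N; apply: H; exact: first_pts_uniq.
Unshelve. all: by end_near. Qed.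

Lemma sum_le_Sum f s : (forall x, 0 <= f x) -> asummable f -> uniq s -> \sum_(x <- s) f x <= Sum f.
Proof.
move=> f0 /Sum_cvg cf us; have [N HN] := first_pts_exhaust s.
rewrite -(cvg_lim _ cf) //; apply: limr_ge; first exact: cvgP cf.
near=> M; apply: ler_sum_sub => // x /HN; apply: first_pts_sub.
by near: M; exact: nbhs_infty_ge.
Unshelve. all: by end_near. Qed.

Lemma ler_Sum f g : asummable f -> asummable g -> (forall x, f x <= g x) -> Sum f <= Sum g.
Proof.
move=> /Sum_cvg cf /Sum_cvg cg fg; rewrite -(cvg_lim _ cf) // -(cvg_lim _ cg) //.
apply: ler_lim; [exact: cvgP cf | exact: cvgP cg |].
by near=> N; apply: ler_sum => x _; exact: fg.
Unshelve. all: by end_near. Qed.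

Lemma Sum_ge0 f : (forall x, 0 <= f x) -> asummable f -> 0 <= Sum f.
Proof. by move=> f0 sf; have := sum_le_Sum f0 sf (s := [::]) isT; rewrite big_nil. Qed.

Lemma eq_Sum f g : (forall x, f x = g x) -> Sum f = Sum g.
Proof. by move=> fg; congr Sum; exact/funext. Qed.

Lemma asummable_reindex f h h' : cancel h h' -> asummable f -> asummable (f \o h).
Proof.
move=> hK [C HC]; exists C => s us.
rewrite -(big_map h xpredT (fun x => `|f x|)); apply: HC.
by rewrite map_inj_uniq //; exact: can_inj hK.
Qed.

(** For nonnegative functions the sum is the supremum of the finite sums, so that it does
    not depend on the enumeration of [X]. *)
Lemma Sum_reindex f h h' : cancel h h' -> cancel h' h -> (forall x, 0 <= f x) -> asummable f ->
  Sum (f \o h) = Sum f.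
Proof.
have le g k k' : cancel k k' -> (forall x, 0 <= g x) -> asummable g -> Sum (g \o k) <= Sum g.
  move=> kK g0 sg; apply: Sum_le; first exact: asummable_reindex kK sg.
  move=> s us; rewrite -(big_map k xpredT g); apply: sum_le_Sum => //.
  by rewrite map_inj_uniq //; exact: can_inj kK.
move=> hK hK' f0 sf; apply/eqP; rewrite eq_le (le f h h') //=.
have sfh := asummable_reindex hK sf.
rewrite {1}(_ : f = (f \o h) \o h'); first by apply: le hK' _ sfh => x /=.
by apply/funext => x /=; rewrite hK'.
Qed.

(** Functions supported by a point. *)
Lemma sum_supp1 f x s : uniq s -> (forall y, y != x -> f y = 0) ->
  \sum_(y <- s) f y = if x \in s then f x else 0.
Proof.
move=> us f0; case: ifP => xs.
  by rewrite (bigD1_seq x) //= big1 ?addr0 // => y; exact: f0.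
rewrite big_seq big1 // => y ys; apply: f0; apply: contraFneq xs => <-; exact: ys.
Qed.

Lemma asummable_supp1 f x : (forall y, y != x -> f y = 0) -> asummable f.
Proof.
move=> f0; exists `|f x| => s us.
rewrite (@sum_supp1 (fun y => `|f y|) x) //; first by case: ifP.
by move=> y /f0 ->; rewrite normr0.
Qed.

Lemma Sum_supp1 f x : (forall y, y != x -> f y = 0) -> Sum f = f x.
Proof.
move=> f0; apply: cvg_lim => //; apply: cvg_near_cst.
have [N HN] := first_pts_exhaust [:: x].
near=> M; rewrite (sum_supp1 (first_pts_uniq M) f0) ifT //.
apply: (@first_pts_sub N); last by apply: HN; rewrite mem_head.
by near: M; exact: nbhs_infty_ge.
Unshelve. all: by end_near. Qed.

(** Functions supported by at most one point. *)
Lemma Sum_subsingleton f : (forall x y, f x != 0 -> f y != 0 -> x = y) ->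
  asummable f /\ ((exists2 x, forall y, y != x -> f y = 0 & Sum f = f x) \/
                  (forall x, f x = 0) /\ Sum f = 0).
Proof.
move=> H; have [[x fx]|N] := pselect (exists x, f x != 0).
  have f0 y : y != x -> f y = 0.
    by move=> yx; apply: contraNeq yx => fy; rewrite (H _ _ fx fy).
  by split; [exact: asummable_supp1 f0 | left; exists x => //; exact: Sum_supp1].
have f0 x : f x = 0 by apply: contra_notP N => /eqP; exists x.
have x0 : X := pts 0; have f0' y : y != x0 -> f y = 0 by [].
by split; [exact: asummable_supp1 f0' | right; split => //; rewrite (Sum_supp1 f0')].
Qed.

End Sums.

(** * Cutting the circular order, and placing the intervals *)

Section CutOrder.
Variables (X : choiceType) (c : X -> X -> X -> int) (x0 : X).
Hypothesis cP : circular_order c.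

(** The linear order with least element [x0] obtained by cutting the circular order at [x0]
    is encoded by the cochain [cut_sign], of coboundary [c]. The value of [cut_sign y z] is
    0, 1 or -1 according to whether [y] is equal to, smaller than or greater than [z]. *)
Definition cut_sign (y z : X) : int := c x0 y z + (y == x0)%:Z - (z == x0)%:Z.

(** The strict order of the cut. *)
Definition cut_lt (y z : X) : bool := cut_sign y z == 1.

Lemma cut_sign_coboundary y z w :
  c y z w = cut_sign z w - cut_sign y w + cut_sign y z.
Proof. by case: cP => _ _ /(_ x0 y z w) H; rewrite /cut_sign; lia. Qed.

Lemma circular_order_diag y z : [/\ c y z z = 0, c y y z = 0 & c y z y = 0].
Proof. by case: cP => _ c0 _; split; apply/c0; [apply: Or33|apply: Or31|apply: Or32]. Qed.

Lemma cut_sign_opp y z : cut_sign z y = - cut_sign y z.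
Proof.
case: cP => _ _ /(_ x0 y z y); rewrite /cut_sign.
by have [_ _ ->] := circular_order_diag y z; have [-> _ _] := circular_order_diag x0 y; lia.
Qed.

Lemma cut_sign_refl y : cut_sign y y = 0.
Proof. by have := cut_sign_opp y y; lia. Qed.

Lemma cut_sign_cases y z : y != z -> cut_sign y z = 1 \/ cut_sign y z = -1.
Proof.
case: cP => cv c0 _ yz; rewrite /cut_sign.
have := c0 x0 y z; have := cv x0 y z; rewrite !inE.
have [yE|yx] := eqVneq y x0.
  have [_ e _] := circular_order_diag x0 z.
  have zN : (z == x0) = false by rewrite -yE eq_sym (negbTE yz).
  by rewrite yE e zN => _ _; left.
have [zE|zx] := eqVneq z x0.
  have [_ _ e] := circular_order_diag x0 y.
  by rewrite zE e => _ _; right.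
move=> /or3P[/eqP->|/eqP->|/eqP->]; [|by left; lia|by right; lia].
by case=> /(_ erefl) [] E; move: yx zx yz; rewrite E eqxx.
Qed.

Lemma cut_sign_lt y z : cut_sign y z = (cut_lt y z)%:Z - (cut_lt z y)%:Z.
Proof.
rewrite /cut_lt (cut_sign_opp y z); have [->|/cut_sign_cases[]->//] := eqVneq y z.
by rewrite cut_sign_refl.
Qed.

Lemma cut_lt_sum y z : ((cut_lt y z : nat) + (cut_lt z y : nat) + (y == z : nat) = 1)%N.
Proof.
rewrite /cut_lt (cut_sign_opp y z); have [->|/cut_sign_cases[]->//] := eqVneq y z.
by rewrite cut_sign_refl.
Qed.

Lemma cut_lt_irr y : cut_lt y y = false.
Proof. by rewrite /cut_lt cut_sign_refl. Qed.

Lemma cut_lt_trans : transitive cut_lt.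
Proof.
move=> z y w /eqP yz /eqP zw; case: cP => cv _ _.
have := cut_sign_coboundary y z w; have := cv y z w; rewrite !inE yz zw.
have [->|/cut_sign_cases[]] := eqVneq y w; rewrite ?cut_sign_refl /cut_lt; first lia.
  by move=> ->.
by move=> ->; lia.
Qed.

Lemma cut_lt_total y z : y != z -> cut_lt y z || cut_lt z y.
Proof. by have := cut_lt_sum y z; case: cut_lt; case: cut_lt => //=; case: eqP. Qed.

Lemma cut_lt_min y : cut_lt y x0 = false.
Proof.
rewrite /cut_lt /cut_sign eqxx; have [_ _ ->] := circular_order_diag x0 y.
by case: (y == x0).
Qed.

(** An injection [h] that preserves [c] preserves the cut order up to a rotation: as a
    number, the truth value of [u < x] is that of [h u < h x], minus that of [h u < h x0],
    plus a term that does not depend on [u]. *)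
Lemma cut_lt_rotate (h : X -> X) : injective h -> cyclic_order_preserving c c h -> forall u x,
  ((cut_lt u x : nat) + (cut_lt (h u) (h x0) : nat) =
   (cut_lt (h u) (h x) : nat) + (cut_lt (h x) (h x0) : nat))%N.
Proof.
move=> hinj hc u x.
have e1 := cut_sign_coboundary (h x0) (h u) (h x).
rewrite (hc x0 u x) in e1.
have e2 : cut_sign u x = c x0 u x + (u == x0)%:Z - (x == x0)%:Z by [].
move: e1 e2; rewrite !cut_sign_lt.
have := cut_lt_sum u x; have := cut_lt_sum (h u) (h x); rewrite (inj_eq hinj).
have := cut_lt_sum (h u) (h x0); have := cut_lt_sum (h x) (h x0); rewrite !(inj_eq hinj).
lia.
Qed.

End CutOrder.

Section Positions.
Variables (R : realType) (X : choiceType) (pts : nat -> X).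
Hypothesis ptsP : forall x, exists n, pts n = x.
Variables (c : X -> X -> X -> int) (x0 : X).
Hypothesis cP : circular_order c.
Variable l : X -> R.
Hypotheses (l_gt0 : forall x, 0 < l x) (l_summable : asummable l) (l_total : Sum pts l = 1).
Local Notation lt := (cut_lt c x0).
Local Notation Sum := (Sum pts).

(** Left endpoint of the interval of length [l x] that corresponds to [x], when these
    intervals are put side by side in [0, 1], following the cut order. *)
Definition position (x : X) : R := Sum (fun y => if lt y x then l y else 0).

Let l0 x : 0 <= l x := ltW (l_gt0 x).

Lemma asummable_restrict (P : X -> bool) : asummable (fun y => if P y then l y else 0).
Proof.
apply: asummable_le l_summable _ => x.
by case: ifP => _; rewrite ?normr0 // ger0_norm.
Qed.
#[local] Hint Resolve asummable_restrict : core.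

Lemma position_ge0 x : 0 <= position x.
Proof. by apply: Sum_ge0 => // y; case: ifP. Qed.

Lemma position_addE x : position x + l x = Sum (fun y => if lt y x || (y == x) then l y else 0).
Proof.
have s1 : asummable (fun y => if y == x then l y else 0) := asummable_restrict (pred1 x).
have -> : l x = Sum (fun y => if y == x then l y else 0).
  by rewrite (@Sum_supp1 _ _ _ ptsP _ x) ?eqxx // => y /negbTE ->.
rewrite -SumD //.
apply: eq_Sum => y; case: (eqVneq y x) => [->|_]; first by rewrite cut_lt_irr // add0r.
by rewrite orbF addr0.
Qed.

Lemma position_le1 x : position x + l x <= 1.
Proof.
by rewrite position_addE -l_total; apply: ler_Sum => // y; case: ifP.
Qed.

Lemma position_lt x y : lt x y -> position x + l x <= position y.
Proof.
move=> xy; rewrite position_addE; apply: ler_Sum => // z.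
case: ifP => [/orP[zx|/eqP->]|_]; [|by rewrite xy|by case: ifP].
by rewrite (cut_lt_trans cP zx xy).
Qed.

Lemma position_min : position x0 = 0.
Proof.
by rewrite /position (_ : (fun y => _) = (fun=> 0));
   [exact: (@Sum_supp1 _ _ _ ptsP (fun=> 0) x0) | apply/funext => y; rewrite cut_lt_min].
Qed.

Lemma position_order x y : x != y ->
  (position x + l x <= position y) || (position y + l y <= position x).
Proof.
by move=> /(cut_lt_total x0 cP)/orP[]/position_lt ->; rewrite ?orbT.
Qed.

(** The points to the left of [p], resp. to the right of [q], have total length at most [p],
    resp. [1 - q]. *)
Lemma sum_left_le (p : R) s : 0 <= p -> uniq s ->
  (forall x, x \in s -> position x + l x <= p) -> \sum_(x <- s) l x <= p.
Proof.
move=> p0 us Hs.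
have [[m [ms Hm]]|->] :
    (exists m, m \in s /\ forall y, y \in s -> (lt y m || (y == m))) \/ s = [::].
- elim: s {us Hs} => [|x s [[m [ms Hm]]|->]]; [by right| |]; left.
    have [xm|xm] := boolP (lt x m).
      exists m; rewrite inE ms orbT; split => // y; rewrite inE => /predU1P[->|/Hm//].
      by rewrite xm.
    exists x; rewrite mem_head; split => // y; rewrite inE => /predU1P[->|/Hm].
      by rewrite eqxx orbT.
    have [->|xNm] := eqVneq x m; first by [].
    have mx : lt m x by have := cut_lt_total x0 cP xNm; rewrite (negbTE xm).
    by case/orP => [ym|/eqP->]; rewrite ?mx // (cut_lt_trans cP ym mx).
  by exists x; rewrite mem_head; split => // y; rewrite inE orbC => /eqP ->; rewrite eqxx.
- apply: le_trans (Hs _ ms); rewrite position_addE.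
  have -> : \sum_(x <- s) l x = \sum_(x <- s) if lt x m || (x == m) then l x else 0.
    by rewrite big_seq [RHS]big_seq; apply: eq_bigr => y /Hm ->.
  by apply: sum_le_Sum => // y; case: ifP.
- by rewrite big_nil.
Qed.

Lemma sum_right_le (q : R) s : q <= 1 -> uniq s ->
  (forall x, x \in s -> q <= position x) -> \sum_(x <- s) l x <= 1 - q.
Proof.
move=> q1 us Hs.
have [[m [ms Hm]]|->] : (exists m, m \in s /\ forall y, y \in s -> ~~ lt y m) \/ s = [::].
- elim: s {us Hs} => [|x s [[m [ms Hm]]|->]]; [by right| |]; left.
    have [xm|xm] := boolP (lt x m).
      exists x; rewrite mem_head; split => // y; rewrite inE => /predU1P[->|/Hm].
        by rewrite cut_lt_irr.
      by apply: contra => yx; exact: cut_lt_trans yx xm.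
    exists m; rewrite inE ms orbT; split => // y; rewrite inE => /predU1P[->//|/Hm//].
  by exists x; rewrite mem_head; split => // y; rewrite inE => /eqP ->; rewrite cut_lt_irr.
- apply: (@le_trans _ _ (1 - position m)); last by rewrite lerD2l lerN2 Hs.
  have -> : \sum_(x <- s) l x = \sum_(x <- s) if ~~ lt x m then l x else 0.
    by rewrite big_seq [RHS]big_seq; apply: eq_bigr => y /Hm ->.
  have -> : 1 - position m = Sum (fun y => if ~~ lt y m then l y else 0).
    rewrite -l_total /position -SumB //; apply: eq_Sum => y.
    by case: ifP => _; rewrite ?subrr ?subr0.
  by apply: sum_le_Sum => // y; case: ifP.
- by rewrite big_nil subr_ge0.
Qed.

Lemma position_dense01 (p q : R) : 0 <= p -> p < q -> q <= 1 ->
  exists x (t : R), [/\ 0 < t, t < l x, p < position x + t & position x + t < q].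
Proof.
move=> p0 pq q1; apply: contrapT => N.
have H x : (position x + l x <= p) || (q <= position x).
  rewrite -[_ || _]negbK negb_or -!ltNge; apply/negP => /andP[h1 h2]; apply: N.
  pose a := Num.max p (position x); pose b := Num.min q (position x + l x).
  have ab : a < b.
    by rewrite /a /b lt_min !gt_max pq h1 h2 /= ltrDl l_gt0.
  exists x, ((a + b) / 2 - position x).
  have h3 : position x <= a by rewrite /a le_max lexx orbT.
  have h4 : p <= a by rewrite /a le_max lexx.
  have h5 : b <= q by rewrite /b ge_min lexx.
  have h6 : b <= position x + l x by rewrite /b ge_min lexx orbT.
  by split; lra.
suff : 1 <= p + (1 - q) by lra.
pose P x := position x + l x <= p.
rewrite -{1}l_total.
have -> : Sum l = Sum (fun x => if P x then l x else 0) + Sum (fun x => if ~~ P x then l x else 0).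
  rewrite -SumD //.
  by apply: eq_Sum => x; case: ifP => _; rewrite ?addr0 ?add0r.
apply: lerD.
  apply: Sum_le => // s us; rewrite -big_mkcond -big_filter.
  by apply: sum_left_le => //; [exact: filter_uniq | move=> x; rewrite mem_filter => /andP[]].
apply: Sum_le => // s us; rewrite -big_mkcond -big_filter.
apply: sum_right_le => //; first exact: filter_uniq.
by move=> x; rewrite mem_filter => /andP[Px _]; have := H x; rewrite -/(P x) (negbTE Px).
Qed.

Lemma position_dense (p q : R) : p < q -> exists (m : int) x (t : R),
  [/\ 0 < t, t < l x, p < position x + t + m%:~R & position x + t + m%:~R < q].
Proof.
move=> pq; pose m := Num.floor p.
have /andP[mp pm] := floor_itv p.
have [||| x [t [t0 tl h1 h2]]] := @position_dense01 (p - m%:~R) (Num.min (q - m%:~R) 1).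
- by rewrite subr_ge0.
- by rewrite lt_min ltrD2r pq /= ltrBlDr; move: pm; rewrite intrD addrC.
- by rewrite ge_min lexx orbT.
exists m, x, t; split => //; first by rewrite -ltrBlDr.
by rewrite -ltrBrDr; apply: lt_le_trans h2 _; rewrite ge_min lexx.
Qed.

End Positions.

(** * The lift of a transformation to the line *)

Section Periodize.
Variable R : realType.

(** [frac_part t] is the representative of [t] modulo 1 in [0, 1[. *)
Definition frac_part (t : R) : R := t - (Num.floor t)%:~R.

Lemma frac_part_addz t (m : int) : frac_part (t + m%:~R) = frac_part t.
Proof.
rewrite /frac_part floorDrz ?intr_int ?num_real // intrKfloor intrD.
by rewrite opprD addrACA subrr addr0.
Qed.

Lemma frac_part_id t : 0 <= t < 1 -> frac_part t = t.
Proof.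
move=> /andP[t0 t1]; rewrite /frac_part (@floor_def _ t 0) ?subr0 //.
by rewrite t0 add0r.
Qed.

Variable u : R -> R.
Hypothesis u_out : forall t : R, ~~ (0 < t < 1) -> u t = 0.

(** Let [u] vanish outside of ]0, 1[. Near any point, even an integer, its periodic
    extension [u \o frac_part] is the sum of two fixed translates of [u]. *)
Lemma periodize_near (t : R) : \forall s \near t,
  u (frac_part s) = u (s - (Num.floor t)%:~R + 1) + u (s - (Num.floor t)%:~R).
Proof.
set n := Num.floor t; have /andP[h1 h2] := floor_itv t.
have h3 : n%:~R - 1 < t by apply: lt_le_trans h1; rewrite ltrBlDr ltrDl.
rewrite -/n in h1 h2.
near=> s.
have s1 : n%:~R - 1 < s by near: s; exact: lt_nbhsr.
have s2 : s < (n + 1)%:~R by near: s; exact: lt_nbhsl.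
rewrite intrD mulr1z in s2.
have [ns|sn] := leP n%:~R s.
  rewrite [u (_ + 1)]u_out; last by rewrite negb_and -!leNgt; apply/orP; right; lra.
  rewrite add0r; congr u; rewrite -(frac_part_addz s (- n)) intrN.
  by apply: frac_part_id; apply/andP; split; lra.
rewrite (@u_out (s - n%:~R)); last by rewrite negb_and -!leNgt; apply/orP; left; lra.
rewrite addr0; congr u; rewrite -(frac_part_addz s (- n + 1)) intrD mulr1z intrN addrA.
by apply: frac_part_id; apply/andP; split; lra.
Unshelve. all: by end_near. Qed.

End Periodize.

Section Lift.
Variables (R : realType) (X : choiceType) (pts : nat -> X).
Hypothesis ptsP : forall x, exists n, pts n = x.
Variables (c : X -> X -> X -> int) (x0 : X).
Hypothesis cP : circular_order c.
Variable l : X -> R.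
Hypotheses (l_gt0 : forall x, 0 < l x) (l_summable : asummable l) (l_total : Sum pts l = 1).
Local Notation lt := (cut_lt c x0).
Local Notation Sum := (Sum pts).
Local Notation pos := (position pts c x0 l).

Section Displacement.
Variables (h h' : X -> X).
Hypotheses (hK : cancel h h') (hK' : cancel h' h).
Hypothesis hc : cyclic_order_preserving c c h.
Hypothesis h_ratio : forall e : R, 0 < e -> exists s : seq X,
  forall x, x \notin s -> (1 - e) * l x <= l (h x) /\ (1 - e) * l (h x) <= l x.

(** Displacement inside of the interval of [x] under the rescaling to length [l (h x)]. It is
    constant on each side of the interval. *)
Definition gap_bump (x : X) (t : R) : R := gap_map (l x) (l (h x)) (t - pos x) - (t - pos x).

(** The derivative of [gap_bump x]. *)
Definition gap_bump_deriv (x : X) (t : R) : R := gap_deriv (l x) (l (h x)) (t - pos x) - 1.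

(** Displacement on [0, 1] of the map that rescales the interval of each [x] to the
    length of the interval of [h x]; it is 0 outside. *)
Definition displacement (t : R) : R := Sum (fun x => gap_bump x t).

(** The derivative of [displacement]. *)
Definition displacement_deriv (t : R) : R := Sum (fun x => gap_bump_deriv x t).

Let lh_summable : asummable (fun x => l (h x)).
Proof. exact: asummable_reindex hK l_summable. Qed.

Lemma gap_bump_le0 x t : t <= pos x -> gap_bump x t = 0.
Proof. by move=> tx; rewrite /gap_bump gap_map_le0 ?subrr // subr_le0. Qed.

Lemma gap_bump_ge x t : pos x + l x <= t -> gap_bump x t = l (h x) - l x.
Proof. by move=> tx; rewrite /gap_bump gap_map_ge //; [ring | lra]. Qed.

Lemma gap_bump_bound x t : `|gap_bump x t| <= l x + l (h x).
Proof.
have lx := l_gt0 x; have lhx := l_gt0 (h x).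
have [tx|tx] := leP t (pos x); first by rewrite gap_bump_le0 // normr0; lra.
have [xt|xt] := leP (pos x + l x) t.
  by rewrite gap_bump_ge // ler_norml; apply/andP; split; lra.
have hx : 0 < t - pos x < l x by lra.
have /andP[] := gap_map_itv lx lhx hx.
by rewrite /gap_bump ler_norml => g0 g1; apply/andP; split; lra.
Qed.

Lemma gap_bump_asummable t : asummable (fun x => gap_bump x t).
Proof.
by apply: asummable_le (asummableD l_summable lh_summable) _ => x; exact: gap_bump_bound.
Qed.

Lemma gap_bump_is_derive x (t : R) : is_derive t 1 (gap_bump x) (gap_bump_deriv x t).
Proof.
have D1 : is_derive t 1 (fun s => s - pos x) 1.
  have -> : (fun s => s - pos x) = (id : R -> R) - cst (pos x) by [].
  by apply: is_derive_eq; rewrite subr0.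
have D2 := gap_map_is_derive (t - pos x) (l_gt0 x) (l_gt0 (h x)).
have D3 := @is_derive1_comp R _ (fun s => s - pos x) t _ _ D2 D1.
have -> : gap_bump x =
  (gap_map (l x) (l (h x)) \o (fun s => s - pos x)) - (fun s => s - pos x) by [].
by apply: is_derive_eq; rewrite mulr1.
Qed.

Lemma gap_bump_deriv_continuous x : continuous (gap_bump_deriv x).
Proof.
move=> t; apply: cvgB; last exact: cvg_cst.
apply: (@continuous_comp _ _ _ (fun s => s - pos x) (gap_deriv (l x) (l (h x)))).
  by apply: cvgB; [exact: cvg_id | exact: cvg_cst].
exact: gap_deriv_continuous.
Qed.

Lemma gap_bump_deriv_supp x t : gap_bump_deriv x t != 0 -> pos x < t < pos x + l x.
Proof.
apply: contra_neqT => tx; rewrite /gap_bump_deriv gap_deriv_out ?subrr //.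
by apply: contra tx => ?; lra.
Qed.

Lemma position_supp_inj x y t : pos x < t < pos x + l x -> pos y < t < pos y + l y -> x = y.
Proof.
move=> tx ty; have [//|/(position_order ptsP x0 cP l_gt0 l_summable) xy] := eqVneq x y.
by suff : false by []; lra.
Qed.

Lemma gap_bump_deriv_inj t x y : gap_bump_deriv x t != 0 -> gap_bump_deriv y t != 0 -> x = y.
Proof. by move=> /gap_bump_deriv_supp tx /gap_bump_deriv_supp; exact: position_supp_inj. Qed.

Lemma gap_bump_deriv_small (e : R) : 0 < e -> exists s : seq X,
  forall x t, x \notin s -> `|gap_bump_deriv x t| <= e.
Proof.
move=> e0; pose e' := Num.min e 1.
have e'0 : 0 < e' by rewrite lt_min e0 /=.
have e'1 : e' <= 1 by rewrite ge_min lexx orbT.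
have e'e : e' <= e by rewrite ge_min lexx.
pose r := (1 + e' / 3)^-1.
have q0 : 0 < 1 + e' / 3 by lra.
have r0 : 0 < r by rewrite invr_gt0.
have r1 : r < 1 by rewrite invf_lt1 //; lra.
have re : r ^- 2 - 1 <= e.
  by rewrite -exprVn /r invrK expr2; nra.
have r1' : 0 < 1 - r by rewrite subr_gt0.
have [s Hs] := h_ratio r1'.
exists s => x t /Hs; rewrite opprB addrCA subrr addr0 => -[h1 h2].
apply: le_trans re; apply: gap_deriv_bound => //.
by rewrite r0 ltW.
Qed.

(** At each point at most one term is nonzero, and the terms are uniformly small outside of
    a finite set of intervals: hence the uniform convergence. *)
Lemma gap_bump_deriv_uniform (e : R) : 0 < e -> exists N, forall n t, (N <= n)%N ->
  `|\sum_(x <- first_pts pts n) gap_bump_deriv x t - displacement_deriv t| <= e.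
Proof.
move=> e0; have [s Hs] := gap_bump_deriv_small e0.
have [N HN] := first_pts_exhaust ptsP s; exists N => n t Nn.
have [_ [[x f0 fE]|[f0 fE]]] := Sum_subsingleton ptsP (@gap_bump_deriv_inj t).
  rewrite /displacement_deriv fE (sum_supp1 (first_pts_uniq pts n) f0).
  case: ifPn => [_|xn]; first by rewrite subrr normr0 ltW.
  rewrite sub0r normrN; apply: Hs; apply: contra xn => /HN; exact: first_pts_sub.
by rewrite /displacement_deriv fE big1 ?subr0 ?normr0 ?ltW // => x _; exact: f0.
Qed.

Lemma is_derive_sum_seq (s : seq X) (f df : X -> R -> R) (t : R) :
  (forall x, is_derive t 1 (f x) (df x t)) ->
  is_derive t 1 (fun t' => \sum_(x <- s) f x t') (\sum_(x <- s) df x t).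
Proof.
move=> Df; elim: s => [|x s IH].
  rewrite big_nil (_ : (fun t' => _) = cst 0); first exact: is_derive_cst.
  by apply/funext => t'; rewrite big_nil.
rewrite big_cons (_ : (fun t' => _) = f x + (fun t' => \sum_(x <- s) f x t')).
  exact: is_deriveD.
by apply/funext => t'; rewrite big_cons.
Qed.

Lemma displacement_is_derive (t : R) : is_derive t 1 displacement (displacement_deriv t).
Proof.
apply: (@is_derive_uniform_limit R (fun n t => \sum_(x <- first_pts pts n) gap_bump x t)
  (fun n t => \sum_(x <- first_pts pts n) gap_bump_deriv x t)).
- by move=> n {}t; apply: is_derive_sum_seq => x; exact: gap_bump_is_derive.
- by move=> {}t; apply: Sum_cvg; exact: gap_bump_asummable.
- exact: gap_bump_deriv_uniform.
Qed.

Lemma displacement_deriv_continuous : continuous displacement_deriv.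
Proof.
apply: continuous_uniform_limit gap_bump_deriv_uniform => n t.
elim: (first_pts pts n) => [|x s IH].
  rewrite (_ : (fun t' => _) = cst 0); first exact: cst_continuous.
  by apply/funext => t'; rewrite big_nil.
rewrite (_ : (fun t' => _) = fun t' => gap_bump_deriv x t' + \sum_(x <- s) gap_bump_deriv x t').
  by apply: cvgD => //; exact: gap_bump_deriv_continuous.
by apply/funext => t'; rewrite big_cons.
Qed.

(** The displacement vanishes to the right of 1 because [h] permutes the lengths. *)
Lemma displacement_out t : ~~ (0 < t < 1) -> displacement t = 0.
Proof.
rewrite negb_and -!leNgt => /orP[t0|t1].
  rewrite /displacement (@eq_Sum _ _ _ _ (fun=> 0)).
    exact: (@Sum_supp1 _ _ _ ptsP (fun=> 0) x0).
  by move=> x; apply: gap_bump_le0; apply: le_trans t0 _; exact: position_ge0.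
rewrite /displacement (@eq_Sum _ _ _ _ (fun x => l (h x) - l x)).
  rewrite SumB // (@Sum_reindex _ _ _ ptsP l h h') // ?subrr // => x; exact: ltW.
by move=> x; apply: gap_bump_ge; apply: le_trans t1; exact: position_le1.
Qed.

(** At each point the derivative of the displacement is 0 or comes from a single interval. *)
Lemma displacement_deriv_cases t : displacement_deriv t = 0 \/
  exists2 x, pos x < t < pos x + l x & displacement_deriv t = gap_bump_deriv x t.
Proof.
have [_ [[x f0 fE]|[_ fE]]] := Sum_subsingleton ptsP (@gap_bump_deriv_inj t); last by left.
have [b0|/gap_bump_deriv_supp tx] := eqVneq (gap_bump_deriv x t) 0; last by right; exists x.
by left; rewrite /displacement_deriv fE.
Qed.

Lemma displacement_deriv_out t : ~~ (0 < t < 1) -> displacement_deriv t = 0.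
Proof.
have [//|[x tx _]] := displacement_deriv_cases t.
have := position_ge0 ptsP c x0 l_gt0 l_summable x.
have := position_le1 ptsP x0 cP l_gt0 l_summable l_total x.
by move=> h1 h2 /negP[]; lra.
Qed.

(** A lift to the line of the circle map that sends the interval of each [x] to that of
    [h x]. *)
Definition rescale_lift (t : R) : R := t + pos (h x0) + displacement (frac_part t).

(** The derivative of [rescale_lift]. *)
Definition rescale_lift_deriv (t : R) : R := 1 + displacement_deriv (frac_part t).

Lemma rescale_lift_addz t (m : int) : rescale_lift (t + m%:~R) = rescale_lift t + m%:~R.
Proof. by rewrite /rescale_lift frac_part_addz; ring. Qed.

Lemma rescale_lift_is_derive (t : R) : is_derive t 1 rescale_lift (rescale_lift_deriv t).
Proof.
set n := (Num.floor t)%:~R : R.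
have Dp : is_derive t 1 (fun s => displacement (frac_part s)) (displacement_deriv (frac_part t)).
  have nE := nbhs_singleton (periodize_near displacement_deriv_out t).
  rewrite nE -/n.
  apply: (@near_eq_is_derive _ _ _ (fun s => displacement (s - n + 1) + displacement (s - n))).
    by apply: filterS (periodize_near displacement_out t) => s ->.
  have D1 (a : R) : is_derive t 1 (fun s => displacement (s + a)) (displacement_deriv (t + a)).
    have Da : is_derive t 1 (fun s => s + a) 1.
      have -> : (fun s => s + a) = (id : R -> R) + cst a by [].
      by apply: is_derive_eq; rewrite addr0.
    have := @is_derive1_comp R _ (fun s => s + a) t _ _ (displacement_is_derive (t + a)) Da.
    by rewrite mulr1.
  have -> : (fun s => displacement (s - n + 1) + displacement (s - n)) =
    (fun s => displacement (s + (- n + 1))) + (fun s => displacement (s - n)).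
    apply/funext => s; rewrite -addrA.
    by rewrite -[RHS]/(displacement (s + (- n + 1)) + displacement (s - n)).
  by rewrite -[t - n + 1]addrA; apply: is_deriveD.
have -> : rescale_lift =
  (id : R -> R) + cst (pos (h x0)) + (fun s => displacement (frac_part s)) by [].
by apply: is_derive_eq; rewrite addr0.
Qed.

Lemma rescale_lift_deriv_continuous : continuous rescale_lift_deriv.
Proof.
move=> t; apply: cvgD; first exact: cvg_cst.
set n := (Num.floor t)%:~R : R.
have nE := nbhs_singleton (periodize_near displacement_deriv_out t).
rewrite nE -/n.
have : displacement_deriv (s - n + 1) + displacement_deriv (s - n) @[s --> t] -->
   displacement_deriv (t - n + 1) + displacement_deriv (t - n).
  apply: cvgD.
    apply: (@continuous_comp _ _ _ (fun s => s - n + 1) displacement_deriv).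
      by apply: cvgD; [apply: cvgB; [exact: cvg_id | exact: cvg_cst] | exact: cvg_cst].
    exact: displacement_deriv_continuous.
  apply: (@continuous_comp _ _ _ (fun s => s - n) displacement_deriv).
    by apply: cvgB; [exact: cvg_id | exact: cvg_cst].
  exact: displacement_deriv_continuous.
apply: cvg_trans; apply: near_eq_cvg.
by apply: filterS (periodize_near displacement_deriv_out t) => s ->.
Qed.

Lemma rescale_lift_deriv_gt0 t : 0 < rescale_lift_deriv t.
Proof.
rewrite /rescale_lift_deriv; have [->|[x _ ->]] := displacement_deriv_cases (frac_part t).
  by rewrite addr0.
by rewrite /gap_bump_deriv addrC subrK; exact: gap_deriv_gt0.
Qed.

Lemma rescale_lift_deriv_bound (r : R) : 0 < r <= 1 ->
  (forall x, r * l x <= l (h x)) -> (forall x, r * l (h x) <= l x) ->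
  forall t, `|rescale_lift_deriv t - 1| <= r ^- 2 - 1.
Proof.
move=> r01 h1 h2 t; rewrite /rescale_lift_deriv addrC addKr.
have [->|[x _ ->]] := displacement_deriv_cases (frac_part t); last exact: gap_deriv_bound.
rewrite normr0 subr_ge0; case/andP: r01 => r0 r1.
by rewrite invf_ge1 ?exprn_gt0 // exprn_ile1 // ltW.
Qed.

(** The interval of [x] is mapped by [gap_map] to a translate, by an integer, of that of
    [h x]. *)
Lemma rescale_lift_gap x : exists m : int, forall s, 0 < s < l x ->
  rescale_lift (pos x + s) = pos (h x) + m%:~R + gap_map (l x) (l (h x)) s.
Proof.
exists (lt (h x) (h x0))%:Z => s sx.
have x0' := position_ge0 ptsP c x0 l_gt0 l_summable x.
have x1' := position_le1 ptsP x0 cP l_gt0 l_summable l_total x.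
rewrite /rescale_lift frac_part_id; last lra.
(* The intervals on the left of that of [x] contribute the full variation of their length,
   those on the right contribute nothing. *)
pose P1 y := if lt y x then l (h y) else 0.
pose P2 y := if lt y x then l y else 0.
pose P3 y := if y == x then gap_map (l x) (l (h x)) s - s else 0.
have s1 : asummable P1.
  apply: asummable_le lh_summable _ => y; rewrite /P1.
  by case: ifP => _; rewrite ?normr0 ?ger0_norm // ltW.
have s2 : asummable P2 by exact: asummable_restrict.
have P30 y : y != x -> P3 y = 0 by rewrite /P3 => /negbTE ->.
have s3 : asummable P3 := asummable_supp1 P30.
have -> : displacement (pos x + s) = Sum (fun y => P1 y - P2 y + P3 y).
  apply: eq_Sum => y; rewrite /P1 /P2 /P3.
  have [->|yx] := eqVneq y x.
    by rewrite cut_lt_irr // subrr add0r /gap_bump addrAC subrr add0r.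
  rewrite addr0; case: ifPn => [lyx|lyx].
    apply: gap_bump_ge; have := position_lt ptsP cP l_gt0 l_summable lyx; clear yx; lra.
  rewrite subrr; apply: gap_bump_le0.
  have lxy : lt x y by have := cut_lt_total x0 cP yx; rewrite (negbTE lyx).
  have := position_lt ptsP cP l_gt0 l_summable lxy; clear yx; lra.
rewrite SumD // ?SumB //; last exact: (asummableD s1 (asummableN s2)).
rewrite (Sum_supp1 ptsP P30) /P3 eqxx -/(pos x).
suff : pos (h x0) + Sum P1 = pos (h x) + (lt (h x) (h x0))%:Z%:~R by move=> E; rewrite -E; ring.
pose Q y := if lt (h' y) x then l y else 0.
have -> : Sum P1 = Sum Q.
  rewrite -(@Sum_reindex _ _ _ ptsP Q h h') //.
  - by apply: eq_Sum => y; rewrite /P1 /Q /= hK.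
  - by move=> y; rewrite /Q; case: ifP => // _; exact: ltW.
  - exact: (asummable_restrict l_gt0 l_summable (fun y => lt (h' y) x)).
rewrite addrC -SumD; last 2 first.
- exact: (asummable_restrict l_gt0 l_summable (fun y => lt (h' y) x)).
- exact: asummable_restrict.
have rot y := cut_lt_rotate x0 cP (can_inj hK) hc (h' y) x.
have -> : (lt (h x) (h x0))%:Z%:~R = Sum (fun y => if lt (h x) (h x0) then l y else 0) :> R.
  case: (lt (h x) (h x0)); rewrite ?l_total //.
  by rewrite (@Sum_supp1 _ _ _ ptsP (fun=> 0) x0).
rewrite -SumD; last 2 first.
- exact: asummable_restrict.
- exact: (asummable_restrict l_gt0 l_summable (fun=> lt (h x) (h x0))).
apply: eq_Sum => y; have := rot y; rewrite hK' /Q.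
by do 4 (case: (lt _ _)); rewrite ?addr0 ?add0r.
Qed.

End Displacement.

End Lift.

(** * Maps of the circle and their lifts *)

Section CircleBasics.
Variable R : realType.
Implicit Types (s t p : R) (xi : circle R).

Lemma toCD s t : toC (s + t) = toC s + toC t :> circle R.
Proof. exact: (@Quotient.pi_add _ (GRing.ZmodClosed.clone R (@Num.int_num_subdef R) _) s t). Qed.

Lemma toCN s : toC (- s) = - toC s :> circle R.
Proof. exact: (@Quotient.pi_opp _ (GRing.ZmodClosed.clone R (@Num.int_num_subdef R) _) s). Qed.

Lemma toCB s t : toC (s - t) = toC s - toC t :> circle R.
Proof. by rewrite toCD toCN. Qed.

Lemma toC_repr xi : toC (repr xi) = xi.
Proof. exact: reprK. Qed.

Lemma toC_eqP s t : toC s = toC t :> circle R <-> exists m : int, s = t + m%:~R.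
Proof.
have E := @Quotient.idealrBE _ (GRing.ZmodClosed.clone R (@Num.int_num_subdef R) _) s t.
split=> [st|[m ->]].
  have /intrP[m mE] : s - t \is a Num.int.
    by apply: (etrans E); apply/eqP; exact: st.
  by exists m; rewrite -mE addrC subrK.
have h : t + m%:~R - t \is a Num.int by rewrite addrC addKr; exact: intr_int.
have /eqP := etrans (esym (@Quotient.idealrBE _
  (GRing.ZmodClosed.clone R (@Num.int_num_subdef R) _) (t + m%:~R) t)) h.
exact.
Qed.

Lemma toC_addz t (m : int) : toC (t + m%:~R) = toC t :> circle R.
Proof. by apply/toC_eqP; exists m. Qed.

Lemma toC_inj_near s t : `|s - t| < 1 -> toC s = toC t :> circle R -> s = t.
Proof.
move=> st /toC_eqP[m sE]; move: st; rewrite sE addrC addKr -intr_norm.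
rewrite -[1]/(1%:~R) ltr_int => m1; have -> : m = 0 by lia.
by rewrite addr0.
Qed.

Lemma rep_from_toC a s : a <= s < a + 1 -> rep_from a (toC s) = s.
Proof.
move=> /andP[as1 as2]; rewrite /rep_from.
set u := repr (toC s); have /toC_eqP[m uE] : toC u = toC s by rewrite toC_repr.
have -> : Num.floor (u - a) = m.
  apply: floor_def; rewrite uE intrD mulr1z.
  by apply/andP; split; lra.
by rewrite uE addrK.
Qed.

(** The circle has the quotient topology. *)
Lemma toC_continuous_lift (f : circle R -> R) : continuous (f \o @toC R) -> continuous f.
Proof.
move=> /continuousP cf; apply/continuousP => A oA.
exact: (cf A oA).
Qed.

(** If the lifts of the points increase along the cut order, and are at distance less than
    1 from each other, then the points are in the circular order [c]. *)
Lemma cut_circle_order (X : choiceType) (c : X -> X -> X -> int) (x0 : X) (a : X -> R) :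
  circular_order c ->
  (forall x y, cut_lt c x0 x y -> a x < a y < a x + 1) ->
  cyclic_order_preserving c (@circle_order R) (@toC R \o a).
Proof.
move=> cP ltP x y z; rewrite /circle_order /=.
have aP u v : u != v -> (cut_lt c x0 u v) /\ a u < a v < a u + 1 \/
    (cut_lt c x0 v u) /\ a v < a u < a v + 1.
  by move=> /(cut_lt_total x0 cP)/orP[] h; [left | right]; split => //; exact: ltP.
have inj u v : u != v -> (toC (a u) == toC (a v)) = false.
  move=> uv; apply/negbTE/eqP => /toC_inj_near H.
  have e : a u = a v.
    by apply: H; rewrite ltr_norml; have [[_ ?]|[_ ?]] := aP _ _ uv; apply/andP; split; lra.
  by have [[_]|[_]] := aP _ _ uv; rewrite e ltxx.
have [_ d1 _] := circular_order_diag cP x z.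
have [d3 _ d2] := circular_order_diag cP x y.
have [<-|xy] := eqVneq x y; first by rewrite eqxx d1.
have [<-|xz] := eqVneq x z; first by rewrite eqxx orbT d2.
have [<-|yz] := eqVneq y z; first by rewrite eqxx !orbT d3.
rewrite !inj //= (cut_sign_coboundary x0 cP).
rewrite -!toCB.
have rep u v : cut_lt c x0 u v -> rep_from 0 (toC (a v - a u)) = a v - a u.
  by move=> /ltP h; apply: rep_from_toC; apply/andP; split; lra.
have rep' u v : cut_lt c x0 v u -> rep_from 0 (toC (a v - a u)) = a v - a u + 1.
  move=> /ltP h; rewrite -(toC_addz _ 1) mulr1z; apply: rep_from_toC; apply/andP; split; lra.
have sg u v : cut_lt c x0 u v -> cut_sign c x0 u v = 1 /\ cut_sign c x0 v u = -1.
  by move=> /eqP h; rewrite (cut_sign_opp x0 cP u v) h.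
have [[l1 h1]|[l1 h1]] := aP _ _ xy; have [[l2 h2]|[l2 h2]] := aP _ _ xz;
  have [[l3 h3]|[l3 h3]] := aP _ _ yz; have [e1 e1'] := sg _ _ l1;
  have [e2 e2'] := sg _ _ l2; have [e3 e3'] := sg _ _ l3;
  rewrite ?e1 ?e1' ?e2 ?e2' ?e3 ?e3' ?(rep _ _ l1) ?(rep _ _ l2) ?(rep' _ _ l1) ?(rep' _ _ l2);
  clear - h1 h2 h3; case: ifPn => //; rewrite -?leNgt => h4; exfalso; lra.
Qed.

End CircleBasics.

Section CircleMap.
Variables (R : realType) (F dF : R -> R).
Hypothesis F_addz : forall t (m : int), F (t + m%:~R) = F t + m%:~R.
Hypothesis F_is_derive : forall t : R, is_derive t 1 F (dF t).
Hypothesis dF_continuous : continuous dF.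

(** The map of the circle with lift [F], defined through a choice of representatives. *)
Definition circle_map (xi : circle R) : circle R := toC (F (repr xi)).

Lemma circle_map_toC t : circle_map (toC t) = toC (F t).
Proof.
have /toC_eqP[m tE] : toC (repr (toC t : circle R)) = toC t :> circle R by rewrite toC_repr.
by rewrite /circle_map tE F_addz toC_addz.
Qed.

(** In the charts, the circle map is given near 0 by the increments of its lift. *)
Lemma circle_map_in_charts (p : R) :
  is_derive (0 : R) 1 (in_charts circle_map (toC p)) (dF p).
Proof.
have cF : F t @[t --> p] --> F p by exact: (is_derive_continuous F_is_derive).
apply: (@near_eq_is_derive _ _ _ (fun t => F (t + p) - F p)).
  have cF0 : F (t + p) - F p @[t --> 0] --> (0 : R).
    rewrite -[X in _ --> X](subrr (F p)); apply: cvgB; last exact: cvg_cst.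
    have c0 : {for 0, continuous (F \o (fun t => t + p))}.
      apply: continuous_comp; last by rewrite add0r; exact: cF.
      by apply: cvgD; [exact: cvg_id | exact: cvg_cst].
    have -> : F p = (F \o (fun t => t + p)) 0 by rewrite /= add0r.
    exact: c0.
  have h2 : 0 < (2^-1 : R) by rewrite invr_gt0.
  have /cvgrPdist_lt/(_ _ h2) := cF0; apply: filterS => t /=.
  rewrite sub0r normrN => ht; rewrite /in_charts -toCD !circle_map_toC -toCB.
  rewrite [p + t]addrC rep_from_toC //.
  by move: ht; rewrite ltr_norml => /andP[h3 h4]; apply/andP; split; lra.
have Dp : is_derive (0 : R) 1 (fun t : R => t + p) 1.
  have -> : (fun t => t + p) = (id : R -> R) + cst p by [].
  by apply: is_derive_eq; rewrite addr0.
have D0 : is_derive (0 + p) 1 F (dF p) by rewrite add0r.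
have := @is_derive1_comp R F (fun t => t + p) 0 _ _ D0 Dp; rewrite mulr1 => D1.
have -> : (fun t => F (t + p) - F p) = (F \o (fun t => t + p)) - cst (F p) by [].
by apply: is_derive_eq; rewrite subr0.
Qed.

Lemma circle_map_D (p : R) : circle_D circle_map (toC p) = dF p.
Proof. by rewrite /circle_D derive1E; case: (circle_map_in_charts p). Qed.

Lemma circle_map_C1 : circle_C1 circle_map.
Proof.
split=> [xi|]; first by rewrite -(toC_repr xi); case: (circle_map_in_charts (repr xi)).
apply: toC_continuous_lift.
by rewrite (_ : _ \o _ = dF) //; apply/funext => p; exact: circle_map_D.
Qed.

End CircleMap.

(** * The action on the circle *)

Section Action.
Variables (R : realType) (G : groupType) (X : choiceType) (act : G -> X -> X).
Hypothesis actP : left_action act.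
Variables (c : X -> X -> X -> int) (x0 : X).
Hypotheses (cP : circular_order c) (act_c : forall g, cyclic_order_preserving c c (act g)).
Variable pts : nat -> X.
Hypothesis ptsP : forall x, exists n, pts n = x.
Variable l : X -> R.
Hypotheses (l_gt0 : forall x, 0 < l x) (l_summable : asummable l) (l_total : Sum pts l = 1).
Hypothesis l_ratio : forall g (e : R), 0 < e -> exists s : seq X,
  forall x, x \notin s -> (1 - e) * l x <= l (act g x).
Local Notation lt := (cut_lt c x0).
Local Notation pos := (position pts c x0 l).

Lemma actK g : cancel (act g) (act g^-1%g).
Proof. by move=> x; rewrite -actP.2 mulVg actP.1. Qed.

Lemma actVK g : cancel (act g^-1%g) (act g).
Proof. by move=> x; rewrite -actP.2 mulgV actP.1. Qed.

Lemma act_ratio g (e : R) : 0 < e -> exists s : seq X, forall x, x \notin s ->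
  (1 - e) * l x <= l (act g x) /\ (1 - e) * l (act g x) <= l x.
Proof.
move=> e0; have [s Hs] := l_ratio g e0; have [s' Hs'] := l_ratio g^-1%g e0.
exists (s ++ [seq act g^-1%g y | y <- s']) => x; rewrite mem_cat negb_or => /andP[xs xs'].
split; first exact: Hs.
rewrite -{2}[x](actK g); apply: Hs'; apply: contra xs' => gx.
by apply/mapP; exists (act g x) => //; rewrite actK.
Qed.

(** A lift of the action of [g] on the circle, and its derivative. *)
Definition act_lift (g : G) : R -> R := rescale_lift pts c x0 l (act g).
Definition act_lift_deriv (g : G) : R -> R := rescale_lift_deriv pts c x0 l (act g).

Lemma act_lift_addz g t (m : int) : act_lift g (t + m%:~R) = act_lift g t + m%:~R.
Proof. exact: rescale_lift_addz. Qed.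

Lemma act_lift_is_derive g (t : R) : is_derive t 1 (act_lift g) (act_lift_deriv g t).
Proof.
by apply: (rescale_lift_is_derive ptsP x0 cP l_gt0 l_summable l_total (actK g) (actVK g) (act_ratio g)).
Qed.

Lemma act_lift_deriv_continuous g : continuous (act_lift_deriv g).
Proof.
exact: (rescale_lift_deriv_continuous ptsP cP l_gt0 l_summable l_total (act_ratio g)).
Qed.

Lemma act_lift_gap g x : exists m : int, forall s, 0 < s < l x ->
  act_lift g (pos x + s) = pos (act g x) + m%:~R + gap_map (l x) (l (act g x)) s.
Proof.
exact: (rescale_lift_gap ptsP x0 cP l_gt0 l_summable l_total (actK g) (actVK g) (@act_c g)).
Qed.

(** The lifts compose up to integers: this holds on the union of the intervals, which is
    dense, hence everywhere by continuity. *)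
Lemma act_lift_comp g h t : exists m : int,
  act_lift (g * h)%g t = act_lift g (act_lift h t) + m%:~R.
Proof.
have gap_comp x (s : R) (k : int) : 0 < s < l x -> exists m : int,
    act_lift (g * h)%g (pos x + s + k%:~R) = act_lift g (act_lift h (pos x + s + k%:~R)) + m%:~R.
  move=> sx; have [m1 H1] := act_lift_gap (g * h)%g x.
  have [m2 H2] := act_lift_gap h x; have [m3 H3] := act_lift_gap g (act h x).
  have s'x := gap_map_itv (l_gt0 x) (l_gt0 (act h x)) sx.
  exists (m1 - m2 - m3); rewrite !act_lift_addz H1 // H2 // actP.2.
  have -> : pos (act h x) + m2%:~R + gap_map (l x) (l (act h x)) s =
    pos (act h x) + gap_map (l x) (l (act h x)) s + m2%:~R by ring.
  rewrite act_lift_addz H3 // gap_map_comp //.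
  by rewrite !intrB; ring.
pose K t := act_lift (g * h)%g t - act_lift g (act_lift h t).
have cK : continuous K.
  have ca k : continuous (act_lift k) by exact: is_derive_continuous (act_lift_is_derive k).
  move=> s; apply: cvgB; first exact: ca.
  by apply: (@continuous_comp _ _ _ (act_lift h) (act_lift g)); exact: ca.
have /andP[] := floor_itv (K t); rewrite le_eqVlt => /predU1P[Kt _|k1 k2].
  by exists (Num.floor (K t)); rewrite Kt addrC subrK.
(* Otherwise [K] takes only non-integral values near [t]. *)
exfalso; set n := Num.floor (K t) in k1 k2.
have : \forall s \near t, n%:~R < K s < (n + 1)%:~R.
  have hn : nbhs (K t) [set y | n%:~R < y < (n + 1)%:~R].
    by near=> y; apply/andP; split; near: y; [exact: lt_nbhsr | exact: lt_nbhsl].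
  exact: (cK t _ hn).
move=> /nbhs_ballP[d /= d0 Hd].
have td : t < t + d by rewrite ltrDl.
have [m [x [s [s0 sl h1 h2]]]] := position_dense ptsP x0 cP l_gt0 l_summable l_total td.
have [|k Hk] := gap_comp x s m; first by rewrite s0.
have hb : `|t - (pos x + s + m%:~R)| < d.
  by rewrite ltr_distlC; apply/andP; split; lra.
have /= := Hd _ hb.
rewrite /K Hk addrC addKr !ltr_int; lia.
Unshelve. all: by end_near. Qed.

Lemma act_lift1 t : act_lift 1%g t = t.
Proof.
rewrite /act_lift /rescale_lift actP.1 (position_min ptsP x0 cP) addr0 /displacement.
rewrite (@eq_Sum _ _ _ _ (fun=> 0)); first by rewrite (@Sum_supp1 _ _ _ ptsP (fun=> 0) x0) // addr0.
by move=> x; rewrite /gap_bump actP.1 gap_map_id // subrr.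
Qed.

(** The action of [g] on the circle. *)
Definition circle_act (g : G) : circle R -> circle R := circle_map (act_lift g).

Lemma circle_act_toC g t : circle_act g (toC t) = toC (act_lift g t).
Proof. exact: circle_map_toC (act_lift_addz g) t. Qed.

Lemma circle_act_comp g h : circle_act (g * h)%g = circle_act g \o circle_act h.
Proof.
apply/funext => xi; rewrite -(toC_repr xi) /= !circle_act_toC.
by have [m ->] := act_lift_comp g h (repr xi); rewrite toC_addz.
Qed.

Lemma circle_act1 : circle_act 1%g = id.
Proof. by apply/funext => xi; rewrite -(toC_repr xi) circle_act_toC act_lift1. Qed.

Lemma circle_actK g : cancel (circle_act g) (circle_act g^-1%g).
Proof.
move=> xi; rewrite -[LHS]/((circle_act g^-1%g \o circle_act g) xi).
by rewrite -circle_act_comp mulVg circle_act1.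
Qed.

Lemma circle_actVK g : cancel (circle_act g^-1%g) (circle_act g).
Proof. by move=> xi; have := circle_actK g^-1%g xi; rewrite invgK. Qed.

Lemma circle_act_D g t : circle_D (circle_act g) (toC t) = act_lift_deriv g t.
Proof. exact: (circle_map_D (act_lift_addz g) (act_lift_is_derive g)). Qed.

Lemma circle_act_C1 g : circle_C1 (circle_act g).
Proof.
exact: (circle_map_C1 (act_lift_addz g) (act_lift_is_derive g) (act_lift_deriv_continuous (g := g))).
Qed.

Lemma circle_act_diff1 : diff1_action circle_act.
Proof.
split=> [g|g h]; last exact: circle_act_comp.
split; first exact: circle_act_C1.
  exists (circle_act g^-1%g); split; [exact: circle_actK | exact: circle_actVK|].
  exact: circle_act_C1.
move=> xi; rewrite -(toC_repr xi) circle_act_D.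
exact: (rescale_lift_deriv_gt0 ptsP x0 cP l_gt0 l_summable).
Qed.

(** The open interval of the circle that corresponds to [x]. *)
Definition gap (x : X) : set (circle R) := Defs.arc (pos x) (pos x + l x).

Lemma gapP x xi : gap x xi <-> exists2 s : R, 0 < s < l x & xi = toC (pos x + s).
Proof.
split=> [[t] /=|[s sx ->]].
  rewrite in_itv /= => /andP[h1 h2] <-; exists (t - pos x); last by rewrite addrC subrK.
  by apply/andP; split; lra.
exists (pos x + s) => //=; rewrite in_itv /=; apply/andP; split; lra.
Qed.

Lemma circle_act_gap g x xi : gap x xi -> gap (act g x) (circle_act g xi).
Proof.
move=> /gapP[s sx ->]; apply/gapP; have [m H] := act_lift_gap g x.
exists (gap_map (l x) (l (act g x)) s); first exact: gap_map_itv.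
by rewrite circle_act_toC H // addrAC toC_addz.
Qed.

Lemma circle_act_stab g x xi : act g x = x -> gap x xi -> circle_act g xi = xi.
Proof.
move=> gx /gapP[s sx ->]; have [m H] := act_lift_gap g x.
by rewrite circle_act_toC H // gx gap_map_id // addrAC toC_addz.
Qed.

Lemma gap_disjoint x y : x <> y -> gap x `&` gap y = set0.
Proof.
move=> /eqP xy; rewrite -subset0 => xi [/gapP[s sx ->] /gapP[s' sy]].
have x1 := position_ge0 ptsP c x0 l_gt0 l_summable x.
have x2 := position_le1 ptsP x0 cP l_gt0 l_summable l_total x.
have y1 := position_ge0 ptsP c x0 l_gt0 l_summable y.
have y2 := position_le1 ptsP x0 cP l_gt0 l_summable l_total y.
have H := position_order ptsP x0 cP l_gt0 l_summable xy.
move=> /toC_inj_near E; have {}E : pos x + s = pos y + s'.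
  by apply: E; clear xy; rewrite ltr_norml; apply/andP; split; lra.
by clear xy; suff : false by []; lra.
Qed.

Lemma gap_dense : dense (\bigcup_x gap x).
Proof.
move=> O [xi Oxi] oO.
have oO' : open (@toC R @^-1` O) by exact: oO.
have : nbhs (repr xi : R) (@toC R @^-1` O).
  by apply: open_nbhs_nbhs; split => //=; rewrite toC_repr.
move=> /nbhs_ballP[d /= d0 Hd].
have td : (repr xi : R) < repr xi + d by rewrite ltrDl.
have [m [x [s [s0 sl h1 h2]]]] := position_dense ptsP x0 cP l_gt0 l_summable l_total td.
exists (toC (pos x + s)); split; last by exists x => //; apply/gapP; exists s => //; rewrite s0.
rewrite -(toC_addz _ m); apply: Hd; rewrite /ball /= ltr_distlC; apply/andP; split; lra.
Qed.

Lemma circle_act_blow_up : blow_up act c circle_act gap.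
Proof.
have le1 x : pos x + l x <= 1 := position_le1 ptsP x0 cP l_gt0 l_summable l_total x.
have ge0 x : 0 <= pos x := position_ge0 ptsP c x0 l_gt0 l_summable x.
have lt_pos x y : lt x y -> pos x + l x <= pos y.
  exact: (position_lt ptsP cP l_gt0 l_summable).
split.
- by split; [exact: gap_disjoint | exact: gap_dense].
- exists pos, (fun x => pos x + l x); split => //.
  + move=> x; have := l_gt0 x; have := le1 x; have := ge0 x => h1 h2 h3.
    by apply/andP; split; lra.
  + apply: (cut_circle_order cP) => x y /lt_pos xy.
    have := l_gt0 x; have := l_gt0 y; have := le1 y; have := ge0 x => h1 h2 h3 h4.
    by apply/andP; split; lra.
  + apply: (cut_circle_order cP) => x y /lt_pos xy.
    have := l_gt0 x; have := l_gt0 y; have := le1 y; have := ge0 x => h1 h2 h3 h4.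
    by apply/andP; split; lra.
- move=> g x; apply/seteqP; split => [_ [xi xxi <-]|xi gxi]; first exact: circle_act_gap.
  exists (circle_act g^-1%g xi); last exact: circle_actVK.
  by rewrite -(actK g x); exact: circle_act_gap.
- by move=> g x gx xi; exact: circle_act_stab.
Qed.

Lemma circle_act_D_bound g (r : R) : 0 < r <= 1 ->
  (forall x, r * l x <= l (act g x)) -> (forall x, r * l (act g x) <= l x) ->
  forall xi, `|circle_D (circle_act g) xi - 1| <= r ^- 2 - 1.
Proof.
move=> r01 h1 h2 xi; rewrite -(toC_repr xi) circle_act_D.
exact: (rescale_lift_deriv_bound ptsP x0 cP l_gt0 l_summable).
Qed.

End Action.

(* How invariant the lengths must be for the derivatives to be within [eps] of 1; compare
   [circle_act_D_bound]. *)
Lemma ratio_for_deriv (R : realType) (eps : R) : 0 < eps ->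
  exists2 r : R, 0 < r < 1 & r ^- 2 - 1 < eps.
Proof.
move=> e0; pose e := Num.min eps 1.
have e'0 : 0 < e by rewrite lt_min e0 /=.
have e'1 : e <= 1 by rewrite ge_min lexx orbT.
have e'e : e <= eps by rewrite ge_min lexx.
exists (1 + e / 4)^-1.
  have q0 : 0 < 1 + e / 4 by lra.
  by rewrite invr_gt0 q0 invf_lt1 //; lra.
by rewrite -exprVn invrK expr2; nra.
Qed.

Theorem theorem3p1 (R : realType) (G : groupType) (X : choiceType)
    (act : G -> X -> X) (c : X -> X -> X -> int)
    (countG : countable [set: G]) (countX : countable [set: X])
    (X_neq0 : [set: X] !=set0)
    (actP : left_action act) (cP : circular_order c)
    (act_c : forall g, cyclic_order_preserving c c (act g))
    (subexp : subexponential_orbits R act) :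
  (exists (rho : G -> circle R -> circle R) (J : X -> set (circle R)),
     diff1_action rho /\ blow_up act c rho J) /\
  (forall (S : set G) (eps : R), finite_set S -> 0 < eps ->
     exists (rho : G -> circle R -> circle R) (J : X -> set (circle R)),
       [/\ diff1_action rho, blow_up act c rho J
         & forall s, S s ->
             (ereal_sup [set `|circle_D (rho s) xi - 1|%:E | xi in setT]
                < eps%:E)%E]).
Proof.
suff H : forall (S : set G) (eps : R), finite_set S -> 0 < eps ->
     exists (rho : G -> circle R -> circle R) (J : X -> set (circle R)),
       [/\ diff1_action rho, blow_up act c rho J
         & forall s, S s ->
             (ereal_sup [set `|circle_D (rho s) xi - 1|%:E | xi in setT]
                < eps%:E)%E].
  split; last exact: H.
  by have [rho [J [h1 h2 _]]] := H set0 1 (finite_set0 _) ltr01; exists rho, J.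
move=> S eps /finite_seqP[S' SE] e0.
have [x0 _] := X_neq0.
have [pts ptsP] := countable_enum x0 countX.
have [r /andP[r0 r1] reps] := ratio_for_deriv e0.
have [|l' [l'0 [C HC] l'r l'S]] := @almost_invariant_weight R G X act countG countX actP subexp x0
  (S' ++ [seq g^-1%g | g <- S']) r; first by rewrite r0.
have l's : asummable l'.
  by exists C => s us; under eq_bigr do rewrite gtr0_norm //; exact: HC.
pose T := Sum pts l'.
have T0 : 0 < T.
  apply: lt_le_trans (sum_le_Sum ptsP (fun x => ltW (l'0 x)) l's (s := [:: x0]) isT).
  by rewrite big_seq1.
(* The lengths are normalized to have sum 1. *)
pose l x := l' x / T.
have l0 x : 0 < l x by rewrite divr_gt0.
have ls : asummable l.
  exists (C / T) => s us; rewrite ler_pdivlMr // mulr_suml.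
  apply: le_trans (HC s us); apply: ler_sum => x _.
  by rewrite gtr0_norm // /l divfK // gt_eqF.
have lT : Sum pts l = 1.
  have cl := @Sum_cvg R X pts l' l's; apply: cvg_lim => //.
  rewrite -(divff (lt0r_neq0 T0)).
  under eq_fun do rewrite -mulr_suml.
  by apply: cvgMl; exact: cl.
have lscale (a : R) x y : a * l' x <= l' y -> a * l x <= l y.
  by move=> h; rewrite /l mulrA ler_pM2r // invr_gt0.
have lr g (e : R) : 0 < e -> exists s : seq X, forall x, x \notin s -> (1 - e) * l x <= l (act g x).
  by move=> /(l'r g)[s Hs]; exists s => x /Hs; exact: lscale.
exists (circle_act act c x0 pts l), (gap c x0 pts l); split.
- exact: circle_act_diff1.
- exact: circle_act_blow_up.
- move=> g; rewrite SE /= => gS.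
  have h1 x : r * l x <= l (act g x).
    by apply/lscale/l'S; rewrite mem_cat gS.
  have h2 x : r * l (act g x) <= l x.
    rewrite -{2}[x](actK actP g); apply/lscale/l'S.
    by rewrite mem_cat map_f ?orbT.
  have r01 : 0 < r <= 1 by rewrite r0 ltW.
  apply: (@le_lt_trans _ _ (r ^- 2 - 1)%:E); last by rewrite lte_fin.
  apply: ge_ereal_sup => _ [xi _ <-]; rewrite lee_fin.
  by apply: (@circle_act_D_bound R G X act).
Qed.
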